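(* Let $\omega:\mathbb{N}\to\mathbb{R}$ be any function with $\omega(n)\to\infty$ as $n\to\infty$, and for an integer $s\ge 2$ let $g_s(n):=\dfrac{n}{e^{\omega(n)\,(\log n)^{1-1/s}}}$. Then for all integers $s\ge 2$, \begin{itemize} \item $\mathrm{RT}(n,K_3,K_{2s-1},g_s(n))=\frac{1}{2}\left(1-\frac{1}{R(3,s)-1}\right)n^2+o(n^2)$, and \item $\mathrm{RT}(n,K_3,K_{2s},g_s(n))=\frac{1}{2}\left(1-\frac{1}{R(3,s)}\right)n^2+o(n^2)$, \end{itemize} as $n\to\infty$.
   Context: A graph $G$ is called $(H_1,H_2)$-free if there is an edge-colouring $\phi:E(G)\to\{1,2\}$ such that for each $i\in\{1,2\}$, the spanning subgraph formed by the edges of colour $i$ contains no copy of $H_i$. $\mathrm{RT}(n,H_1,H_2,m)$ denotes the maximum number of edges of an $n$-vertex $(H_1,H_2)$-free graph $G$ with independence number $\alpha(G)\le m$. $R(3,s)$ is the Ramsey number: the least $N$ such that every red/blue colouring of the edges of $K_N$ contains a blue $K_3$ or a red $K_s$. $K_s$ is the complete graph on $s$ vertices.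
   Formalization: The formal theorem also assumes that ω grows slowly: for some c > 1/2, g_s(n) ≥ n^c for all large n. For arbitrary ω the claim fails: with ω(n) = n, g_s(n) < 1, so no n-vertex graph has independence number at most g_s(n). *)

(* Defs.v *)
From HB Require Import structures.
From mathcomp Require Import all_boot all_order all_algebra.

Set Implicit Arguments.
Unset Strict Implicit.
Unset Printing Implicit Defensive.

Import Order.TTheory GRing.Theory Num.Theory.

(* A simple graph with vertex type T is its set of edges, each edge being the
   2-element set of its endpoints. *)
Record sgraph (T : finType) := SGraph {
  edges :> {set {set T}};
  edges_card2 : [forall e in edges, #|e| == 2] }.

HB.instance Definition _ (T : finType) := [isSub for @edges T].
HB.instance Definition _ (T : finType) := [Finite of sgraph T by <:].

Section Graphs.
Implicit Types T U : finType.

Lemma complete_card2 T :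
  [forall e in [set e : {set T} | #|e| == 2], #|e| == 2].
Proof. by apply/forall_inP => e; rewrite inE. Qed.

Definition complete (s : nat) : sgraph 'I_s := SGraph (complete_card2 'I_s).

(* Copies are not required to be induced. *)
Definition has_copy T U (G : sgraph T) (H : sgraph U) : bool :=
  [exists f : {ffun U -> T},
     injectiveb f && [forall e in edges H, f @: e \in edges G]].

(* Edge-colourings with two colours are represented by functions to bool, true
   being the first colour and false the second. They are defined on all sets of
   vertices, but only their values on the edges of the graph are ever used. *)
Definition colouring T := {ffun {set T} -> bool}.

Lemma colour_class_card2 T (G : sgraph T) (phi : colouring T) (c : bool) :
  [forall e in [set e in edges G | phi e == c], #|e| == 2].
Proof.
apply/forall_inP => e; rewrite inE => /andP[eG _].
exact: (forall_inP (edges_card2 G)).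
Qed.

Definition colour_class T (G : sgraph T) (phi : colouring T) (c : bool) :
  sgraph T := SGraph (colour_class_card2 G phi c).

(* G is (H1, H2)-free. *)
Definition free2 T U1 U2 (H1 : sgraph U1) (H2 : sgraph U2) (G : sgraph T) :
  bool :=
  [exists phi : colouring T,
     ~~ has_copy (colour_class G phi true) H1 &&
     ~~ has_copy (colour_class G phi false) H2].

Definition independent T (G : sgraph T) (A : {set T}) : bool :=
  [forall e in edges G, ~~ (e \subset A)].

Definition alpha T (G : sgraph T) : nat :=
  \max_(A : {set T} | independent G A) #|A|.

(* The bound m on the independence number is real and is not rounded. The value
   is 0 when no n-vertex graph satisfies the constraints. *)
Definition RT (R : numDomainType) (n : nat) U1 U2
    (H1 : sgraph U1) (H2 : sgraph U2) (m : R) : nat :=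
  \max_(G : sgraph 'I_n | free2 H1 H2 G && ((alpha G)%:R <= m)%R) #|edges G|.

Definition arrows (k l N : nat) : bool :=
  [forall phi : colouring 'I_N,
     has_copy (colour_class (complete N) phi true) (complete k) ||
     has_copy (colour_class (complete N) phi false) (complete l)].

Definition mono T (phi : colouring T) (c : bool) (B : {set T}) : Prop :=
  forall x y, x \in B -> y \in B -> x != y -> phi [set x; y] = c.

Lemma mono_setU1 T (phi : colouring T) (c : bool) (v : T) (B : {set T}) :
  mono phi c B -> (forall x, x \in B -> phi [set v; x] = c) ->
  mono phi c (v |: B).
Proof.
move=> mB vB x y /setU1P[->|xB] /setU1P[->|yB]; rewrite ?eqxx // => xy.
- exact: vB.
- by rewrite setUC; exact: vB.
- exact: mB.
Qed.

Lemma ramsey_mono (k l : nat) : exists N : nat,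
  forall T (phi : colouring T) (A : {set T}), N <= #|A| ->
  (exists B : {set T}, [/\ B \subset A, #|B| = k & mono phi true B]) \/
  (exists B : {set T}, [/\ B \subset A, #|B| = l & mono phi false B]).
Proof.
have m0 T (phi : colouring T) c : mono phi c set0 by move=> x y; rewrite inE.
elim: k l => [|k IHk] l.
  by exists 0 => T phi A _; left; exists set0; rewrite sub0set cards0.
elim: l => [|l [N2 H2]].
  by exists 0 => T phi A _; right; exists set0; rewrite sub0set cards0.
have [N1 H1] := IHk l.+1.
exists (N1 + N2).+1 => T phi A leA.
have /card_gt0P[v vA] : 0 < #|A| by apply: leq_trans leA.
pose P (c : bool) := [set x in A :\ v | phi [set v; x] == c].
have sP c : P c \subset A.
  by apply/subsetP => x; rewrite !inE => /andP[/andP[]].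
have vP c (B : {set T}) : B \subset P c -> v \notin B.
  by move=> sB; apply/negP => /(subsetP sB); rewrite !inE eqxx.
have phiP c (B : {set T}) x : B \subset P c -> x \in B -> phi [set v; x] = c.
  by move=> sB /(subsetP sB); rewrite inE => /andP[_ /eqP].
have extend c (B : {set T}) j : B \subset P c -> #|B| = j -> mono phi c B ->
    [/\ v |: B \subset A, #|v |: B| = j.+1 & mono phi c (v |: B)].
  move=> sB cB mB; split.
  - by rewrite subUset sub1set vA (subset_trans sB).
  - by rewrite cardsU1 (vP c) // cB.
  - by apply: mono_setU1 => // x; exact: phiP.
have cP : #|P true| + #|P false| = #|A :\ v|.
  rewrite -(cardsID [set x | phi [set v; x]] (A :\ v)); congr (_ + _);
    by apply: eq_card => x; rewrite !inE ?eqb_id ?eqbF_neg // andbC.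
have le12 : N1 + N2 <= #|P true| + #|P false|.
  by move: leA; rewrite cP (cardsD1 v A) vA.
have [le1|lt1] := leqP N1 #|P true|.
- have [[B [sB cB mB]]|[B [sB cB mB]]] := H1 T phi (P true) le1.
  + by left; exists (v |: B); exact: extend.
  + by right; exists B; split=> //; exact: (subset_trans sB (sP _)).
- have le2 : N2 <= #|P false|.
    rewrite leqNgt; apply/negP => lt2.
    by have := leq_add lt1 (ltnW lt2); rewrite addSn ltnNge le12.
  have [[B [sB cB mB]]|[B [sB cB mB]]] := H2 T phi (P false) le2.
  + by left; exists B; split=> //; exact: (subset_trans sB (sP _)).
  + by right; exists (v |: B); exact: extend.
Qed.

Lemma mono_has_copy (N k : nat) (phi : colouring 'I_N) (c : bool)
    (B : {set 'I_N}) :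
  #|B| = k -> mono phi c B ->
  has_copy (colour_class (complete N) phi c) (complete k).
Proof.
move=> <- mB; apply/existsP; exists [ffun i => enum_val i].
have injf : injective [ffun i : 'I_#|B| => enum_val i].
  by move=> i j; rewrite !ffunE => /enum_val_inj.
apply/andP; split; first exact/injectiveP.
apply/forall_inP => e; rewrite !inE => e2; rewrite card_imset // e2 /=.
case/cards2P: e2 => x [y [xy ->]]; rewrite imsetU1 imset_set1 !ffunE.
by apply/eqP/mB; rewrite ?enum_valP // (inj_eq enum_val_inj).
Qed.

Lemma ramsey_exists (k l : nat) : exists N, arrows k l N.
Proof.
have [N HN] := ramsey_mono k l; exists N; apply/forallP => phi.
have [|[B [_ cB mB]]|[B [_ cB mB]]] := HN _ phi [set: 'I_N].
- by rewrite cardsT card_ord.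
- by rewrite (mono_has_copy cB mB).
- by rewrite (mono_has_copy cB mB) orbT.
Qed.

Definition ramsey (k l : nat) : nat := ex_minn (ramsey_exists k l).

End Graphs.

From mathcomp Require Import all_classical all_reals all_analysis.
Import numFieldNormedType.Exports.

Local Open Scope ring_scope.

Definition gs (R : realType) (omega : nat -> R) (s n : nat) : R :=
  n%:R / expR (omega n * ln (n%:R) `^ (1 - s%:R^-1)).

(* Main.v *)
(* Upper bound. Let m = n e^(-L/2) and alpha(G) <= n e^(-L), L = omega(n) (log n)^(1-1/s).
   Take W maximal among the vertex sets to which no vertex sends more than
   |W| alpha(G) / m edges of colour 1. Since the colour-1 neighbourhood of a vertex in
   a set without edges of colour 2 is independent, every set of m vertices outside W
   spans an edge of colour 2, and deleting the o(n^2) edges of colour 1 at W leaves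
   only colour 2 there. If G has too many edges, a positive proportion of the r-tuples
   of vertices are cliques, with r = R(3,s), resp. r = R(3,s) + 1. Pairing up the
   vertices of such a clique lying in W and applying Ramsey's theorem gives a of its
   vertices outside W and b inside W, spanning only colour 2, with
   2 a + b >= 2 s - 1, resp. 2 s. Dependent random choice, one coordinate at a time,
   doubles each of the a vertices into an edge of colour 2.

   Lower bound. Blow up the vertices of an extremal colouring of the complete graph on
   R(3,s) - 1 vertices and put a triangle-free graph with independence number at most
   n^c, c > 1/2, inside each part, in colour 2; for K_{2s} add one more part, joined
   to the others in colour 2 and with its inner edges in colour 1. The triangle-free
   graph is a random graph of density 1 / (8 sqrt n) minus a maximal family of
   edge-disjoint triangles. *)
Require Import Defs.
From mathcomp Require Import all_boot all_order all_algebra.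
From mathcomp Require Import fingroup perm ring lra zify.
Set Implicit Arguments.
Unset Strict Implicit.
Unset Printing Implicit Defensive.
Import Order.TTheory GRing.Theory Num.Theory.
Local Open Scope ring_scope.

(** * Supersaturation of cliques *)

Definition upd (I : finType) (T : Type) (y : {ffun I -> T}) (i : I) (v : T) :
  {ffun I -> T} := [ffun j => if j == i then v else y j].

Lemma upd_same (I : finType) (T : Type) (y : {ffun I -> T}) i v :
  upd y i v i = v.
Proof. by rewrite ffunE eqxx. Qed.

Lemma upd_other (I : finType) (T : Type) (y : {ffun I -> T}) i j v :
  j != i -> upd y i v j = y j.
Proof. by rewrite ffunE => /negbTE->. Qed.

Lemma upd_upd (I : finType) (T : Type) (y : {ffun I -> T}) i v w :
  upd (upd y i v) i w = upd y i w.
Proof. by apply/ffunP => j; rewrite !ffunE; case: eqP. Qed.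

Lemma upd_id (I : finType) (T : Type) (y : {ffun I -> T}) i : upd y i (y i) = y.
Proof. by apply/ffunP => j; rewrite !ffunE; case: eqP => [->|]. Qed.

(** Exchanging [v] with the entry [y i] is an involution on the pairs [(y, v)], so resampling one
    coordinate of a uniform tuple leaves it uniform. *)
Lemma resample_sum (I T : finType) (M : nmodType) (F : {ffun I -> T} -> M) i :
  \sum_y \sum_v F (upd y i v) = (\sum_y F y) *+ #|T|.
Proof.
pose h (p : {ffun I -> T} * T) := (upd p.1 i p.2, p.1 i).
have hK : involutive h.
  by case=> y v; rewrite /h /= upd_same upd_upd upd_id.
rewrite pair_bigA /= (reindex_inj (inv_inj hK)) /=.
under eq_bigr do rewrite upd_upd upd_id.
rewrite -(pair_bigA _ (fun y (_ : T) => F y)) /=.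
by under eq_bigr do rewrite sumr_const; rewrite sumrMnl.
Qed.

Lemma resample_pair (R : realFieldType) (I T : finType) (F : T -> T -> R)
    (a b : I) : a != b ->
  #|T|%:R ^+ 2 * (\sum_(y : {ffun I -> T}) F (y a) (y b)) =
  #|{ffun I -> T}|%:R * \sum_v \sum_w F v w.
Proof.
move=> ab.
transitivity (\sum_(y : {ffun I -> T}) \sum_v \sum_w
   F (upd (upd y a v) b w a) (upd (upd y a v) b w b)).
  rewrite (resample_sum (fun z : {ffun I -> T} =>
    \sum_w F (upd z b w a) (upd z b w b))).
  rewrite (resample_sum (fun z : {ffun I -> T} => F (z a) (z b))).
  by rewrite expr2 -natrM mulr_natl mulrnA.
rewrite mulr_natl -sumr_const; apply: eq_bigr => y _.
apply: eq_bigr => v _; apply: eq_bigr => w _.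
by rewrite upd_same upd_other // upd_same.
Qed.

Definition clique_on (I : finType) (T : Type) (adj : rel T) (y : {ffun I -> T})
    (A : {set I}) : bool :=
  [forall i in A, forall j in A, (i != j) ==> adj (y i) (y j)].

Lemma clique_onP (I : finType) (T : Type) (adj : rel T) (y : {ffun I -> T})
    (A : {set I}) :
  reflect (forall i j, i \in A -> j \in A -> i != j -> adj (y i) (y j))
          (clique_on adj y A).
Proof.
apply: (iffP forall_inP) => [H i j iA jA ij|H i iA].
  by have /forall_inP/(_ j jA)/implyP/(_ ij) := H i iA.
by apply/forall_inP => j jA; apply/implyP; exact: H.
Qed.

(** Coordinates outside [A] stay free, so cliques of all sizes are counted among the same tuples and
    ratios of counts are ratios of densities. *)
Definition nclique (R : realFieldType) (I T : finType) (adj : rel T)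
    (A : {set I}) : R := \sum_(y : {ffun I -> T}) (clique_on adj y A)%:R.

Lemma nclique_perm (R : realFieldType) (I T : finType) (adj : rel T)
    (s : {perm I}) (A : {set I}) :
  nclique R adj (s @: A) = nclique R adj A.
Proof.
pose h (y : {ffun I -> T}) := [ffun i => y (s i)] : {ffun I -> T}.
pose h' (y : {ffun I -> T}) := [ffun i => y ((s^-1)%g i)] : {ffun I -> T}.
have hK : cancel h h' by move=> y; apply/ffunP => i; rewrite !ffunE permKV.
have h'K : cancel h' h by move=> y; apply/ffunP => i; rewrite !ffunE permK.
rewrite /nclique [RHS](reindex h) /=; last by exists h' => y _.
apply: eq_bigr => y _; congr (_%:R); congr nat_of_bool.
apply/clique_onP/clique_onP => [H i j iA jA ij|H i j].
  by rewrite !ffunE; apply: H; rewrite ?imset_f // (inj_eq perm_inj).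
move=> /imsetP[k kA ->] /imsetP[l lA ->]; rewrite (inj_eq perm_inj) => kl.
by have := H k l kA lA kl; rewrite !ffunE.
Qed.

Lemma card_prefix (r k : nat) : (k <= r)%N ->
  #|[pred i : 'I_r | (i < k)%N]| = k.
Proof. by move=> kr; rewrite -sum1_card (big_ord_narrow kr) sum1_card card_ord. Qed.

Definition prefix_set (r k : nat) : {set 'I_r} := [set i : 'I_r | (i < k)%N].

Lemma nclique_prefixD1 (R : realFieldType) (T : finType) (adj : rel T)
    (r k : nat) (i : 'I_r) : (k < r)%N -> (i <= k)%N ->
  nclique R adj (prefix_set r k.+1 :\ i) = nclique R adj (prefix_set r k).
Proof.
move=> kr ik; rewrite -(nclique_perm R adj (tperm i (Ordinal kr)) (_ :\ _)).
congr nclique; apply/setP => j; rewrite !inE.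
have -> : (j \in [set tperm i (Ordinal kr) x | x in prefix_set r k.+1 :\ i]) =
    (tperm i (Ordinal kr) j \in prefix_set r k.+1 :\ i).
  by rewrite -[in LHS](tpermK i (Ordinal kr) j) (mem_imset _ _ perm_inj).
rewrite !inE; case: tpermP => [->|->|/eqP ji /eqP jk] /=.
- rewrite ltnS leqnn andbT ltn_neqAle ik andbT.
  by rewrite -(inj_eq val_inj) /= eq_sym.
- by rewrite eqxx ltnn.
- by rewrite ji ltnS leq_eqVlt; rewrite -(inj_eq val_inj) /= in jk; rewrite (negbTE jk).
Qed.

(** If [v] is adjacent to all [k.+1] entries, it extends the clique, and each of the [k.+1]
    replacements counts at most 1. Otherwise [v] misses some entry, and only that entry can be
    replaced by [v]. *)
Lemma extension_count (R : realFieldType) (T : finType) (adj : rel T)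
    (r k : nat) (l : 'I_r) (y : {ffun 'I_r -> T}) (v : T) :
  symmetric adj -> l = k.+1 :> nat ->
  \sum_(i < r | (i < k.+1)%N) ((clique_on adj y (prefix_set r k.+1))%:R *
     (clique_on adj (upd y i v) (prefix_set r k.+1))%:R) <=
  (clique_on adj y (prefix_set r k.+1))%:R +
  k%:R * (clique_on adj (upd y l v) (prefix_set r k.+2))%:R :> R.
Proof.
move=> sadj lk; rewrite -big_distrr /=.
have [cy|] := boolP (clique_on adj y _); last first.
  by move=> _; rewrite mul0r add0r mulr_ge0.
have kr : (k.+1 < r)%N by rewrite -lk.
have crd : (\sum_(i < r | (i < k.+1)%N) 1 = k.+1%:R :> R).
  by rewrite sumr_const card_prefix // ltnW.
rewrite !mul1r; have [H|] := boolP [forall j : 'I_r, (j < k.+1)%N ==> adj v (y j)].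
  have -> : clique_on adj (upd y l v) (prefix_set r k.+2).
    apply/clique_onP => i j; rewrite !inE !ltnS => ik jk ij; rewrite !ffunE.
    have aux (i' j' : 'I_r) : (i' <= k.+1)%N -> i' != l -> (i' < k.+1)%N.
      by move=> + il; rewrite leq_eqVlt ltnS -lk (inj_eq val_inj) (negbTE il).
    have [il|il] := eqVneq i l; have [jl|jl] := eqVneq j l.
    - by move: ij; rewrite il jl eqxx.
    - by move/forallP/(_ j)/implyP: H; apply; exact: aux.
    - by rewrite sadj; move/forallP/(_ i)/implyP: H; apply; exact: aux.
    - by move/clique_onP: cy; apply=> //; rewrite inE aux.
  rewrite mulr1 -natr1 in crd *; rewrite addrC -crd.
  by apply: ler_sum => i _; rewrite lern1 leq_b1.
rewrite negb_forall => /existsP[j0]; rewrite negb_imply => /andP[j0k nadj].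
rewrite (bigD1 j0) //= big1 ?addr0 => [|i /andP[ik ij0]].
  by rewrite (@le_trans _ _ 1) ?lern1 ?leq_b1 // lerDl mulr_ge0.
case: clique_onP => // /(_ i j0); rewrite !inE ik j0k => /(_ isT isT ij0).
by rewrite upd_same upd_other 1?eq_sym // (negbTE nadj).
Qed.

(* The Moon-Moser inequality, by double counting pairs of a clique y and a vertex
   v that can replace the coordinate i of y. *)
Lemma nclique_ratio (R : realFieldType) (T : finType) (adj : rel T)
    (r k : nat) (alpha : R) :
  symmetric adj -> (0 < #|T|)%N -> (k.+1 < r)%N -> 0 <= alpha ->
  alpha * nclique R adj (prefix_set r k) <= nclique R adj (prefix_set r k.+1) ->
  (k.+1%:R * alpha - 1) * nclique R adj (prefix_set r k.+1) <=
  k%:R * nclique R adj (prefix_set r k.+2).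
Proof.
move=> sadj T0 kr al0 Hal; set n : R := #|T|%:R.
have n0 : 0 < n by rewrite ltr0n.
set Hs := nclique R adj (prefix_set r k.+1) in Hal *.
pose c (y : {ffun 'I_r -> T}) : R := (clique_on adj y (prefix_set r k.+1))%:R.
pose A i := \sum_(y : {ffun 'I_r -> T}) \sum_v (c y * c (upd y i v)).
have lowA (i : 'I_r) : (i < k.+1)%N -> alpha * n * Hs <= A i.
  move=> ik; pose d y := \sum_v c (upd y i v).
  pose b (y : {ffun 'I_r -> T}) : R :=
    (clique_on adj y (prefix_set r k.+1 :\ i))%:R.
  have sd : \sum_y d y = n * Hs by rewrite resample_sum mulr_natl.
  have sd2 : \sum_y d y ^+ 2 = n * A i.
    rewrite mulr_natl -(resample_sum _ i); apply: eq_bigr => y _.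
    rewrite expr2 /d big_distrl; apply: eq_bigr => v _ /=.
    rewrite big_distrr; apply: eq_bigr => w _ /=; by rewrite upd_upd.
  have sb : \sum_y b y = nclique R adj (prefix_set r k).
    by rewrite -(@nclique_prefixD1 R T adj r k i) // ltnW.
  have db y : d y * b y = d y.
    rewrite /b; case: clique_onP; rewrite (mulr1, mulr0) // => H.
    rewrite /d big1 // => v _; rewrite /c; case: clique_onP => // H'.
    exfalso; apply: H => a a' /setD1P[ai ak] /setD1P[a'i a'k] aa'.
    by have := H' a a' ak a'k aa'; rewrite !upd_other.
  have bb y : b y * b y = b y by rewrite /b; case: clique_on; rewrite ?mulr1 ?mulr0.
  (* Cauchy-Schwarz written as a square. Since [d] vanishes where [b] does, expanding it involves
     only the sums of [d], [d ^+ 2] and [b]. *)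
  have : 0 <= \sum_y (d y - alpha * n * b y) ^+ 2.
    by apply: sumr_ge0 => y _; rewrite sqr_ge0.
  have -> : \sum_y (d y - alpha * n * b y) ^+ 2 =
     \sum_y (d y ^+ 2 - 2 * alpha * n * d y + (alpha * n) ^+ 2 * b y).
    apply: eq_bigr => y _.
    transitivity (d y ^+ 2 - 2 * alpha * n * (d y * b y) +
                  (alpha * n) ^+ 2 * (b y * b y)); first by ring.
    by rewrite db bb.
  rewrite !big_split /= sumrN -!big_distrr /= sd2 sd sb => H0.
  rewrite -(ler_pM2l n0).
  have := ler_wpM2l (mulr_ge0 al0 (sqr_ge0 n)) Hal.
  by move: H0; rewrite -/n; lra.
have upA : \sum_(i < r | (i < k.+1)%N) A i <=
    n * Hs + k%:R * (n * nclique R adj (prefix_set r k.+2)).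
  rewrite /A exchange_big /=.
  under eq_bigr do rewrite exchange_big /=.
  pose l := Ordinal kr.
  have -> : n * nclique R adj (prefix_set r k.+2) = \sum_(y : {ffun 'I_r -> T}) \sum_v
      (clique_on adj (upd y l v) (prefix_set r k.+2))%:R.
    rewrite (resample_sum (fun z : {ffun 'I_r -> T} =>
      (clique_on adj z (prefix_set r k.+2))%:R : R)).
    by rewrite mulr_natl.
  have -> : n * Hs = \sum_(y : {ffun 'I_r -> T}) \sum_(v : T) c y.
    by under [RHS]eq_bigr do rewrite sumr_const; rewrite sumrMnl mulr_natl.
  rewrite big_distrr -big_split /=; apply: ler_sum => y _.
  rewrite big_distrr -big_split /=; apply: ler_sum => v _.
  exact: extension_count.
have : \sum_(i < r | (i < k.+1)%N) (alpha * n * Hs) <= \sum_(i < r | (i < k.+1)%N) A i.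
  by apply: ler_sum => i; exact: lowA.
rewrite sumr_const card_prefix ?(ltnW kr) //.
move=> /le_trans/(_ upA); rewrite -mulr_natl => H.
by rewrite -(ler_pM2l n0); move: H; rewrite -!/Hs; lra.
Qed.

(** Iterate Moon-Moser from the edge density [1 - x]: the ratio of the counts of [k.+1]-cliques and
    [k]-cliques is at least [1 - k x], which is at least [eta] for all [k < r]. *)
Lemma supersaturation (R : realFieldType) (T : finType) (adj : rel T) (r : nat)
    (eta : R) :
  symmetric adj -> (0 < #|T|)%N -> (2 <= r)%N -> 0 < eta -> eta <= 1 ->
  (1 - (1 - eta) / (r.-1)%:R) * #|T|%:R ^+ 2 <= \sum_v \sum_w (adj v w)%:R ->
  eta ^+ r.-1 * #|{ffun 'I_r -> T}|%:R <=
  #|[set y : {ffun 'I_r -> T} | clique_on adj y setT]|%:R.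
Proof.
move=> sadj T0 r2 eta0 eta1 Hadj; set N : R := #|_|%:R.
set x := (1 - eta) / (r.-1)%:R in Hadj.
have r1 : 0 < (r.-1)%:R :> R by rewrite ltr0n -ltnS prednK // ltnW.
have x0 : 0 <= x by rewrite divr_ge0 ?subr_ge0 // ltW.
have xk k : (k < r)%N -> eta <= 1 - k%:R * x.
  move=> kr; suff : k%:R * x <= 1 - eta by lra.
  rewrite /x mulrA ler_pdivrMr // mulrC ler_wpM2l ?subr_ge0 //.
  by rewrite ler_nat -ltnS prednK // ltnW.
pose H k := nclique R adj (prefix_set r k).
have H1 : H 1%N = N.
  rewrite /H /nclique /N -sum1_card natr_sum; apply: eq_bigr => y _.
  case: clique_onP => // -[] i j; rewrite !inE !ltnS !leqn0 => /eqP i0 /eqP j0.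
  by rewrite -(inj_eq val_inj) /= i0 j0.
have H2 : (1 - x) * H 1%N <= H 2.
  have r0 : (0 < r)%N by apply: ltnW.
  have -> : H 2 = \sum_(y : {ffun 'I_r -> T})
      (adj (y (Ordinal r0)) (y (Ordinal r2)))%:R.
    apply: eq_bigr => y _; congr (_%:R); congr nat_of_bool.
    apply/clique_onP/idP => [h|h i j]; first by apply: h; rewrite ?inE.
    rewrite !inE => i2 j2 ij.
    have [i0|i0] := eqVneq i (Ordinal r0); have [j0|j0] := eqVneq j (Ordinal r0).
    - by move: ij; rewrite i0 j0 eqxx.
    - have -> // : j = Ordinal r2; last by rewrite i0.
      by apply: val_inj; move: j0 j2; rewrite -(inj_eq val_inj) /=; case: (val j) => [|[|]].
    - have -> // : i = Ordinal r2; last by rewrite j0 sadj.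
      by apply: val_inj; move: i0 i2; rewrite -(inj_eq val_inj) /=; case: (val i) => [|[|]].
    - move: ij i0 j0 i2 j2; rewrite -!(inj_eq val_inj) /=.
      by case: (val i) (val j) => [|[|]] // [|[|]].
  have n2 : 0 < #|T|%:R ^+ 2 :> R by rewrite exprn_gt0 // ltr0n.
  rewrite -(ler_pM2l n2) (@resample_pair R _ T (fun v w => (adj v w)%:R)) //.
  rewrite H1 -/N; have := ler_wpM2l (ler0n R #|{ffun 'I_r -> T}|) Hadj.
  by rewrite -/N; lra.
have step k : (0 < k)%N -> (k < r)%N -> (1 - k%:R * x) * H k <= H k.+1.
  elim: k => // -[_ _ _|k IH _ kr]; first by rewrite mul1r.
  have h := IH isT (ltnW kr).
  have := nclique_ratio sadj T0 kr (le_trans (ltW eta0) (xk _ (ltnW kr))) h.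
  have -> : k.+2%:R * (1 - k.+1%:R * x) - 1 = k.+1%:R * (1 - k.+2%:R * x) :> R.
    by rewrite -!natr1; ring.
  by rewrite -mulrA ler_pM2l // ltr0n.
have low k : (k < r)%N -> eta ^+ k * N <= H k.+1.
  elim: k => [_|k IH kr]; first by rewrite expr0 mul1r H1.
  have := step k.+1 isT kr; apply: le_trans.
  rewrite exprS -mulrA; apply: ler_pM; rewrite ?(ltW eta0) ?xk ?IH ?(ltnW kr) //.
  by rewrite mulr_ge0 ?exprn_ge0 ?ler0n // ltW.
have : H r <= #|[set y : {ffun 'I_r -> T} | clique_on adj y setT]|%:R.
  rewrite /H /nclique -sum1_card natr_sum big_mkcond /= [leRHS]big_mkcond /=.
  apply: ler_sum => y _; rewrite inE.
  have -> : prefix_set r r = setT by apply/setP => i; rewrite !inE ltn_ord.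
  by case: clique_on.
apply: le_trans; have := low r.-1; rewrite (prednK (ltnW r2)) leqnn.
exact.
Qed.

(** * Dependent random choice *)

(** Convexity: the tangent at [mu] lies below the power. Multiplying the induction hypothesis by [a]
    leaves the gap [q.+1%:R * mu ^+ q * (a - mu) ^+ 2]. *)
Lemma exprn_tangent (R : realFieldType) (a mu : R) (q : nat) :
  0 <= a -> 0 <= mu ->
  mu ^+ q.+1 + q.+1%:R * mu ^+ q * (a - mu) <= a ^+ q.+1.
Proof.
move=> a0 mu0; elim: q => [|q IH]; first by rewrite expr0 !expr1; lra.
have h1 := ler_wpM2l a0 IH.
have h2 : 0 <= q.+1%:R * mu ^+ q * (a - mu) ^+ 2.
  by rewrite mulr_ge0 ?sqr_ge0 // mulr_ge0 ?exprn_ge0.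
rewrite [a ^+ q.+2]exprS; apply: le_trans h1; rewrite -subr_ge0.
apply: le_trans h2 _; rewrite le_eqVlt; apply/orP; left; apply/eqP.
by rewrite -[q.+2%:R]natr1 !exprS; ring.
Qed.

(** Sum the tangent lines at [mu]; the linear terms add up to a nonnegative number because [mu] does
    not exceed the mean. *)
Lemma power_mean (R : realFieldType) (X : finType) (f : X -> R) (mu : R) (q : nat) :
  (forall x, 0 <= f x) -> 0 <= mu -> mu * #|X|%:R <= \sum_x f x ->
  #|X|%:R * mu ^+ q <= \sum_x f x ^+ q.
Proof.
move=> f0 mu0 Hf; case: q => [|q].
  by under eq_bigr do rewrite expr0; rewrite sumr_const mulr1.
have := ler_sum (index_enum X) (fun x (_ : true) => exprn_tangent q (f0 x) mu0).
apply: le_trans; rewrite big_split /= sumr_const -big_distrr sumrB sumr_const /=.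
rewrite -[mu ^+ _ *+ _]mulr_natl lerDl mulr_ge0 ?subr_ge0 //.
  by rewrite mulr_ge0 ?exprn_ge0.
by rewrite -mulr_natr.
Qed.

Lemma sum_ffun_all (R : realFieldType) (Y : finType) (q : nat) (P : pred Y) :
  \sum_(w : {ffun 'I_q -> Y}) [forall k, P (w k)]%:R = #|P|%:R ^+ q :> R.
Proof.
rewrite -natrX -[in RHS](card_ord q) -card_ffun_on -natr_sum; congr (_%:R).
rewrite -sum1_card [RHS]big_mkcond /=; apply: eq_bigr => w _.
have -> : (w \in ffun_on P) = [forall k, P (w k)] by apply/familyP/forallP.
by case: forallP.
Qed.

(* The weight #|A| - #|X| * bad w is positive only when no pair is bad, so no
   vertex has to be deleted from A. *)
Lemma dependent_random_choice (R : realFieldType) (X Y : finType)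
    (E : X -> Y -> bool) (d d' m : R) (q : nat) :
  (0 < #|Y|)%N -> 0 <= d -> 0 <= d' -> 0 < m ->
  d * #|X|%:R * #|Y|%:R <= \sum_x #|[pred y | E x y]|%:R ->
  m <= #|X|%:R * d ^+ q - #|X|%:R ^+ 3 * d' ^+ q ->
  exists A : {set X}, m <= #|A|%:R /\
    forall u v, u \in A -> v \in A ->
      d' * #|Y|%:R <= #|[pred y | E u y && E v y]|%:R.
Proof.
move=> Y0 d0 d'0 m0 HE Hm; set N : R := #|Y|%:R.
have N0 : 0 < N by rewrite ltr0n.
(* [A w] is the common neighbourhood of the [q] samples [w]. A bad pair has few common neighbours,
   so it rarely lies in [A w]. *)
pose A (w : {ffun 'I_q -> Y}) := [set x | [forall k, E x (w k)]].
pose isbad (p : X * X) := (#|[pred y | E p.1 y && E p.2 y]|%:R < d' * N).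
pose bad w : R := \sum_(p | isbad p) ((p.1 \in A w) && (p.2 \in A w))%:R.
have bad0 w : 0 <= bad w by apply: sumr_ge0.
have sA : #|X|%:R * (d * N) ^+ q <= \sum_w #|A w|%:R.
  have -> : \sum_w #|A w|%:R = \sum_x #|[pred y | E x y]|%:R ^+ q :> R.
    under [RHS]eq_bigr do rewrite -sum_ffun_all.
    rewrite exchange_big /=; apply: eq_bigr => w _.
    rewrite -sum1_card natr_sum big_mkcond /=; apply: eq_bigr => x _.
    by rewrite inE; case: forallP.
  apply: power_mean => //; first by rewrite mulr_ge0 // ltW.
  by rewrite mulrAC.
have sbad : \sum_w bad w <= #|X|%:R ^+ 2 * (d' * N) ^+ q.
  have -> : \sum_w bad w = \sum_(p | isbad p)
      #|[pred y | E p.1 y && E p.2 y]|%:R ^+ q.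
    under [RHS]eq_bigr do rewrite -sum_ffun_all.
    rewrite exchange_big /=; apply: eq_bigr => p _; apply: eq_bigr => w _.
    rewrite !inE; congr (_%:R); congr nat_of_bool.
    apply/andP/forallP => [[/forallP h1 /forallP h2] k /=|h].
      by rewrite h1 h2.
    by split; apply/forallP => k; have /andP[] := h k.
  apply: (@le_trans _ _ (\sum_(p | isbad p) (d' * N) ^+ q)).
    apply: ler_sum => p bp; apply: lerXn2r; rewrite ?nnegrE ?ler0n //.
      by apply: le_trans (ltW bp).
    exact: ltW.
  rewrite sumr_const -[leLHS]mulr_natl ler_wpM2r ?exprn_ge0 ?mulr_ge0 ?(ltW N0) //.
  by rewrite -natrX ler_nat -mulnn -card_prod max_card.
have [w Hw|now] := pickP (fun w => m <= #|A w|%:R - #|X|%:R * bad w).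
  exists (A w); split.
    by apply: le_trans Hw _; rewrite lerBlDr lerDl mulr_ge0.
  move=> u v uA vA; rewrite leNgt; apply/negP => buv.
  have : 1 <= bad w.
    rewrite /bad (bigD1 (u, v)) //= uA vA lerDl.
    by apply: sumr_ge0.
  move=> /(ler_wpM2l (ler0n R #|X|)); rewrite mulr1 => h.
  have h2 : #|A w|%:R <= #|X|%:R :> R by rewrite ler_nat max_card.
  by move: Hw m0; lra.
(* Averaging: if every sample had weight below [m], the total would contradict the moment bounds
   [sA] and [sbad]. *)
have : \sum_w (#|A w|%:R - #|X|%:R * bad w) < \sum_(w : {ffun 'I_q -> Y}) m.
  have /card_gt0P[y0 _] := Y0.
  rewrite (bigD1 [ffun=> y0]) //= [ltRHS](bigD1 [ffun=> y0]) //=.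
  apply: ltr_leD; first by rewrite ltNge now.
  by apply: ler_sum => w _; rewrite ltW // ltNge now.
rewrite sumrB -big_distrr sumr_const card_ffun card_ord /= -[ltRHS]mulr_natr natrX -/N.
have Nq : 0 < N ^+ q by rewrite exprn_gt0.
have := ler_wpM2l (ler0n R #|X|) sbad.
have := ler_wpM2r (ltW Nq) Hm.
by rewrite !exprMn; move: sA; rewrite !exprMn; lra.
Qed.

(* Dependent random choice is applied to one coordinate at a time; the common
   link of a pair found in one coordinate is the hypergraph for the next. *)
Lemma double_coordinates (R : realFieldType) (I T : finType) (e : rel T)
    (U : {set T}) (d : nat -> R) (q : nat -> nat) (m : R) (s : nat) :
  (0 < #|T|)%N -> 0 < m -> (forall a, 0 < d a) ->
  (forall A : {set T}, A \subset U -> m <= #|A|%:R ->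
     exists u v, [/\ u \in A, v \in A & e u v]) ->
  (forall a, (a < s)%N ->
     m <= #|T|%:R * d a.+1 ^+ q a - #|T|%:R ^+ 3 * d a ^+ q a) ->
  forall (S : seq I) (H : {set {ffun I -> T}}),
  uniq S -> (size S <= s)%N ->
  (forall y i, y \in H -> i \in S -> y i \in U) ->
  d (size S) * #|{ffun I -> T}|%:R <= #|H|%:R ->
  exists y u v : {ffun I -> T},
    (forall i, i \in S -> e (u i) (v i)) /\
    (forall z : {ffun I -> T}, (forall i, i \in S -> z i = u i \/ z i = v i) ->
       (forall i, i \notin S -> z i = y i) -> z \in H).
Proof.
move=> T0 m0 d0 HU Hq.
have /card_gt0P[t0 _] := T0.
have Om0 : (0 < #|{ffun I -> T}|)%N by apply/card_gt0P; exists [ffun=> t0].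
elim=> [|i S IH] H.
  move=> _ _ _ /= h.
  have /card_gt0P[y yH] : (0 < #|H|)%N.
    by rewrite -(ltr0n R); apply: lt_le_trans h; rewrite mulr_gt0 ?ltr0n.
  exists y, y, y; split=> // z _ zy.
  by have -> : z = y by apply/ffunP => j; apply: zy.
move=> /= /andP[iS uS] sS HH dH.
have [A [mA hA]] : exists A : {set T}, m <= #|A|%:R /\
    forall u v, u \in A -> v \in A -> d (size S) * #|{ffun I -> T}|%:R <=
      #|[pred y : {ffun I -> T} | (upd y i u \in H) && (upd y i v \in H)]|%:R.
  apply: (@dependent_random_choice _ T {ffun I -> T} (fun x y => upd y i x \in H)
    (d (size S).+1) _ _ (q (size S))) => //.
  - exact: ltW.
  - exact: ltW.
  - have -> : \sum_x #|[pred y : {ffun I -> T} | upd y i x \in H]|%:R = #|H|%:R * #|T|%:R :> R.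
      transitivity (\sum_(y : {ffun I -> T}) \sum_x (upd y i x \in H)%:R : R).
        rewrite exchange_big; apply: eq_bigr => x _ /=.
        by rewrite -sum1_card natr_sum big_mkcond; apply: eq_bigr => y _; rewrite inE; case: ifP.
      rewrite (resample_sum (fun y : {ffun I -> T} => (y \in H)%:R : R)) -[LHS]mulr_natr.
      rewrite -[in RHS]sum1_card natr_sum [in RHS]big_mkcond /=; congr (_ * _).
      by apply: eq_bigr => y _; case: ifP.
    by rewrite mulrAC ler_wpM2r.
  - exact: Hq.
(* Take both members of the pair equal to [x]: the link of [x] is nonempty, so [x] is the entry at
   [i] of some member of [H]. *)
have AU : A \subset U.
  apply/subsetP => x xA; have := hA x x xA xA => h.
  have /card_gt0P[y] : (0 < #|[pred y : {ffun I -> T} | (upd y i x \in H) && (upd y i x \in H)]|)%N.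
    by rewrite -(ltr0n R); apply: lt_le_trans h; rewrite mulr_gt0 ?ltr0n.
  rewrite inE andbb => yH; have := HH _ i yH; rewrite upd_same; apply.
  by rewrite mem_head.
have [u0 [v0 [u0A v0A euv]]] := HU A AU mA.
pose H' := [set y : {ffun I -> T} | (upd y i u0 \in H) && (upd y i v0 \in H)].
have [||y [u [v [e1 e2]]]] := IH H' uS (ltnW sS).
- move=> y j; rewrite inE => /andP[yH _] jS.
  have ji : j != i by apply: contraNneq iS => <-.
  by have := HH _ j yH; rewrite upd_other //; apply; rewrite inE jS orbT.
- by rewrite /H' cardsE; exact: hA.
exists y, (upd u i u0), (upd v i v0); split=> [j|z zS zy].
  rewrite inE => /orP[/eqP->|jS]; first by rewrite !upd_same.
  have ji : j != i by apply: contraNneq iS => <-.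
  by rewrite !upd_other //; exact: e1.
have : upd z i (y i) \in H'.
  apply: e2 => j jS.
    have ji : j != i by apply: contraNneq iS => <-.
    have := zS j; rewrite inE jS orbT => /(_ isT).
    by rewrite !upd_other.
  have [->|ji] := eqVneq j i; first by rewrite upd_same.
  by rewrite upd_other //; apply: zy; rewrite inE negb_or ji.
rewrite inE !upd_upd => /andP[h1 h2].
have := zS i; rewrite mem_head !upd_same => /(_ isT) zi.
by rewrite -(upd_id z i); case: zi => ->.
Qed.

(** * Upper bound *)

Lemma edge_neq (T : finType) (G : sgraph T) (x y : T) :
  [set x; y] \in edges G -> x != y.
Proof.
move=> xy; have /forall_inP/(_ _ xy) := edges_card2 G.
by rewrite cards2; case: (x != y).
Qed.

Lemma in_colour_class (T : finType) (G : sgraph T) phi c (e : {set T}) :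
  (e \in edges (colour_class G phi c)) = (e \in edges G) && (phi e == c).
Proof. by rewrite inE. Qed.

(** Injectivity of [f] on [J] comes for free, since an edge has two distinct ends. Any index set
    with at least [k] elements may be used. *)
Lemma has_copy_complete (I T : finType) (G : sgraph T) (J : {set I}) (f : I -> T)
    (k : nat) :
  (k <= #|J|)%N ->
  (forall i j, i \in J -> j \in J -> i != j -> [set f i; f j] \in edges G) ->
  has_copy G (complete k).
Proof.
move=> kJ H; pose g (i : 'I_k) : I := enum_val (widen_ord kJ i).
have gJ i : g i \in J by exact: enum_valP.
have ginj i j : i != j -> g i != g j.
  apply: contraNneq => /enum_val_inj/(congr1 (@nat_of_ord _)) /= ij.
  exact/eqP/ord_inj.
apply/existsP; exists [ffun i => f (g i)]; apply/andP; split.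
  apply/injectiveP => i j; rewrite !ffunE => fij; apply/eqP/negPn/negP => ij.
  by have /edge_neq := H _ _ (gJ i) (gJ j) (ginj _ _ ij); rewrite fij eqxx.
apply/forall_inP => e; rewrite inE => /cards2P[x [y [xy ->]]].
by rewrite imsetU1 imset_set1 !ffunE; apply: H; rewrite ?gJ ?ginj.
Qed.

Lemma copy_complete_edges (T : finType) (G : sgraph T) (k : nat) :
  has_copy G (complete k) ->
  exists f : 'I_k -> T, forall i j, i != j -> [set f i; f j] \in edges G.
Proof.
move=> /existsP[f /andP[_ /forall_inP H]]; exists f => i j ij.
by have := H [set i; j]; rewrite imsetU1 imset_set1; apply; rewrite inE cards2 ij.
Qed.

Lemma has_copy_triangle (T : finType) (G : sgraph T) (x y z : T) :
  [set x; y] \in edges G -> [set x; z] \in edges G -> [set y; z] \in edges G ->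
  has_copy G (complete 3).
Proof.
move=> xy xz yz; pose f (i : 'I_3) := nth x [:: x; y; z] i.
apply: (@has_copy_complete _ _ _ [set: 'I_3] f); first by rewrite cardsT card_ord.
move=> i j _ _; rewrite -(inj_eq val_inj) /f.
case: i j => [[|[|[|i]]] ?] [[|[|[|j]]] ?] //= _; rewrite // setUC; by [].
Qed.

Lemma set2_inj (T : finType) (a b c d : T) :
  [set a; b] = [set c; d] -> a != b -> (a = c /\ b = d) \/ (a = d /\ b = c).
Proof.
move=> E ab.
have : a \in [set c; d] by rewrite -E !inE eqxx.
have : b \in [set c; d] by rewrite -E !inE eqxx orbT.
rewrite !inE => /orP[/eqP bc|/eqP bd] /orP[/eqP ac|/eqP ad]; subst; auto.
- by rewrite eqxx in ab.
- by rewrite eqxx in ab.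
Qed.

(* The indices of Wi are grouped in pairs; giving the two members of a pair the
   first colour and all other edges at Wi the second keeps the first colour
   triangle-free, and a clique of the second colour meets each pair once. *)
Lemma ramsey_pairing (N s : nat) (col : rel 'I_N) (Wi : {set 'I_N}) :
  arrows 3 s N -> symmetric col ->
  (forall f : 'I_3 -> 'I_N, (forall a b, a != b ->
      [/\ f a \notin Wi, f a != f b & col (f a) (f b)]) -> False) ->
  exists S : {set 'I_N}, [/\ [disjoint S & Wi],
    forall i j, i \in S -> j \in S -> i != j -> ~~ col i j,
    (#|S| <= s)%N & (2 * s <= 2 * #|S| + #|Wi| + 1)%N].
Proof.
(* [h] numbers the pairs: positions [2k] and [2k + 1] in [enum Wi] both get [k]. *)
move=> arr scol notri; pose h i := (index i (enum Wi))./2.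
have idxI i j : i \in Wi -> j \in Wi -> index i (enum Wi) = index j (enum Wi) -> i = j.
  by rewrite -!(mem_enum Wi) => iW jW; apply: index_inj.
pose rho i j := if i \in Wi then (j \in Wi) && (h i == h j)
                else (j \notin Wi) && col i j.
have srho i j : rho i j = rho j i.
  by rewrite /rho scol (eq_sym (h i)); case: (i \in Wi); case: (j \in Wi).
pose psi : colouring 'I_N := [ffun e => [exists i, exists j,
  [&& e == [set i; j], i != j & rho i j]]].
have psiE i j : i != j -> psi [set i; j] = rho i j.
  move=> ij; rewrite ffunE; apply/existsP/idP => [[a /existsP[b]]|rij].
    move=> /and3P[/eqP /set2_inj/(_ ij)[[-> ->]|[-> ->]] _] //.
    by rewrite srho.
  by exists i; apply/existsP; exists j; rewrite eqxx ij rij.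
have := forallP arr psi => /orP[] /copy_complete_edges[f Hf].
  have Hr a b : a != b -> f a != f b /\ rho (f a) (f b).
    move=> ab; have := Hf a b ab; move=> /[dup]/edge_neq fab.
    by rewrite in_colour_class psiE // => /andP[_ /eqP].
  (* [rho] never joins [Wi] to its complement, so the triangle lies on one side. Outside [Wi] it is
     excluded by [notri]; inside, three distinct positions would share one half. *)
  exfalso; have [f0W|f0W] := boolP (f ord0 \in Wi); last first.
    apply: (notri f) => a b ab; have [fab rab] := Hr a b ab.
    suff fW : f a \notin Wi.
      by split=> //; move: rab; rewrite /rho (negbTE fW) => /andP[].
    have [->|a0] := eqVneq a ord0; first by [].
    have [_] := Hr _ _ a0; rewrite /rho; case: ifP => // _.
    by rewrite (negbTE f0W).
  pose i1 : 'I_3 := Ordinal (isT : 1 < 3)%N; pose i2 : 'I_3 := Ordinal (isT : 2 < 3)%N.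
  have [f01 r01] := Hr ord0 i1 isT; have [f02 r02] := Hr ord0 i2 isT.
  have [f12 _] := Hr i1 i2 isT.
  move: r01 r02; rewrite /rho f0W => /andP[f1W /eqP h1] /andP[f2W /eqP h2].
  have d01 : index (f ord0) (enum Wi) <> index (f i1) (enum Wi).
    by move=> /idxI h01; rewrite h01 ?eqxx in f01.
  have d02 : index (f ord0) (enum Wi) <> index (f i2) (enum Wi).
    by move=> /idxI h02; rewrite h02 ?eqxx in f02.
  have d12 : index (f i1) (enum Wi) <> index (f i2) (enum Wi).
    by move=> /idxI h12; rewrite h12 ?eqxx in f12.
  move: h1 h2 d01 d02 d12; rewrite /h; move: (index _ _) (index _ _) (index _ _).
  by clear; lia.
have Hr a b : a != b -> f a != f b /\ ~~ rho (f a) (f b).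
  move=> ab; have := Hf a b ab; move=> /[dup]/edge_neq fab.
  by rewrite in_colour_class psiE // => /andP[_ /eqP->].
have finj : injective f.
  move=> a b fab; apply/eqP/negPn/negP => /Hr[]; by rewrite fab eqxx.
pose F := [set f a | a : 'I_s].
have cF : #|F| = s by rewrite card_imset // card_ord.
have Frho i j : i \in F -> j \in F -> i != j -> ~~ rho i j.
  move=> /imsetP[a _ ->] /imsetP[b _ ->]; rewrite (inj_eq finj) => ab.
  by have [] := Hr a b ab.
exists (F :\: Wi); split.
- by rewrite disjoint_sym disjoints_subset; apply/subsetP => i; rewrite !inE => ->.
- move=> i j; rewrite !inE => /andP[iW iF] /andP[jW jF] ij.
  by have := Frho i j iF jF ij; rewrite /rho (negbTE iW) jW.
- by rewrite -cF; apply: subset_leq_card; apply: subsetDl.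
(* [h] is injective on [F :&: Wi]; a last index without partner accounts for the [+ 1]. *)
have cI : (2 * #|F :&: Wi| <= #|Wi| + 1)%N.
  have hlt i : i \in Wi -> (h i < uphalf #|Wi|)%N.
    move=> iW; rewrite /h; have : (index i (enum Wi) < #|Wi|)%N.
      by rewrite cardE index_mem mem_enum.
    by lia.
  have [w0|/card_gt0P[w wW]] := posnP #|Wi|.
    by rewrite (cards0_eq w0) setI0 cards0.
  pose h' i : 'I_(uphalf #|Wi|) := insubd (Ordinal (hlt w wW)) (h i).
  have : (#|h' @: (F :&: Wi)| <= uphalf #|Wi|)%N.
    by rewrite -[X in (_ <= X)%N]card_ord max_card.
  rewrite card_in_imset; first by lia.
  move=> i j /setIP[iF iW] /setIP[jF jW] /(congr1 val).
  rewrite !val_insubd !hlt // => hij; apply/eqP/negPn/negP => ij.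
  by have := Frho i j iF jF ij; rewrite /rho iW jW hij eqxx.
by have := cardsID Wi F; rewrite cF; lia.
Qed.

(** For [r = N.+1] one index [i0] is set aside, inside [Wi] if possible; putting it back gains the
    missing 1. If [Wi] is empty, the gain comes from parity: [2 * s <= 2 * #|S| + 1] forces
    [s <= #|S|]. *)
Lemma ramsey_split (N s r p : nat) (col : rel 'I_r) (Wi : {set 'I_r}) :
  arrows 3 s N -> symmetric col ->
  (r = N /\ p = 2 * s - 1 \/ r = N.+1 /\ p = 2 * s)%N ->
  (forall f : 'I_3 -> 'I_r, (forall a b, a != b ->
      [/\ f a \notin Wi, f a != f b & col (f a) (f b)]) -> False) ->
  exists S : {set 'I_r}, [/\ [disjoint S & Wi],
    forall i j, i \in S -> j \in S -> i != j -> ~~ col i j,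
    (#|S| <= s)%N & (p <= 2 * #|S| + #|Wi|)%N].
Proof.
move=> arr scol [] [rE pE] notri; subst r.
  have [S [S1 S2 S3 S4]] := ramsey_pairing arr scol notri.
  by exists S; split=> //; lia.
have [i0 Hi0] : exists i0, (i0 \in Wi) || (Wi == set0).
  have [->|/set0Pn[i iW]] := eqVneq Wi set0; first by exists ord0; rewrite orbT.
  by exists i; rewrite iW.
pose W' := lift i0 @^-1: Wi.
have [||S [S1 S2 S3 S4]] := @ramsey_pairing N s
    (fun i j => col (lift i0 i) (lift i0 j)) W' arr.
- by move=> i j; rewrite scol.
- move=> f Hf; apply: (notri (fun a => lift i0 (f a))) => a b /Hf[].
  by rewrite inE (inj_eq (@lift_inj _ i0)).
have cS : #|lift i0 @: S| = #|S| by rewrite card_imset //; exact: lift_inj.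
have cW : (#|W'| + (Wi != set0) <= #|Wi|)%N.
  case/orP: Hi0 => [iW|/eqP W0]; last first.
    by rewrite /W' W0 preimset0 cards0 eqxx.
  have /set0Pn -> : exists i, i \in Wi by exists i0.
  rewrite [X in (_ <= X)%N](cardsD1 i0) iW addnC leq_add2l.
  rewrite -(card_imset _ (@lift_inj _ i0)); apply: subset_leq_card.
  apply/subsetP => j /imsetP[i]; rewrite inE => iW' ->.
  by rewrite !inE iW' andbT eq_sym neq_lift.
have cW0 : Wi = set0 -> #|W'| = 0%N.
  by move=> W0; rewrite /W' W0 preimset0 cards0.
exists (lift i0 @: S); split.
- rewrite disjoints_subset; apply/subsetP => j /imsetP[i iS ->].
  by have /pred0P/(_ i) := S1; rewrite !inE /= iS /= => ->.
- move=> _ _ /imsetP[i iS ->] /imsetP[j jS ->].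
  by rewrite (inj_eq (@lift_inj _ i0)); exact: S2.
- by rewrite cS.
rewrite cS pE; have [W0|W0] := eqVneq Wi set0.
  by move: S4; rewrite (cW0 W0); lia.
by apply: leq_trans S4 _; rewrite -addnA leq_add2l; move: cW; rewrite W0.
Qed.

(** * From many edges to a clique of the second colour *)

Lemma sum_adjacent (R : realFieldType) (T : finType) (G : sgraph T) :
  \sum_v \sum_w ([set v; w] \in edges G)%:R = (2 * #|edges G|)%:R :> R.
Proof.
rewrite pair_bigA /= -natr_sum; congr (_%:R).
rewrite -big_mkcond /= (partition_big (fun p : T * T => [set p.1; p.2])
  [in edges G]) //= mulnC -sum_nat_const; apply: eq_bigr => e eG.
have /cards2P[x [y [xy eE]]] := forall_inP (edges_card2 G) e eG.
rewrite sum1_card (_ : 2%N = #|[set (x, y); (y, x)]|); last first.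
  by rewrite cards2 xpair_eqE (negbTE xy).
apply: eq_card => -[a b]; rewrite !inE unfold_in /= !xpair_eqE.
apply/andP/orP => [[_ /eqP/esym]|].
  by rewrite eE => /set2_inj/(_ xy)[[-> ->]|[-> ->]]; rewrite !eqxx; [left|right].
by move=> [] /andP[/eqP-> /eqP->]; rewrite ?[[set y; x]]setUC -eE eG.
Qed.

(* W collects vertices whose inner edges have the first colour only: no vertex
   sends many edges of the first colour to W, and outside W every large set
   spans an edge of the second colour. *)
Lemma first_colour_part (R : realFieldType) (T : finType) (G : sgraph T)
    (phi : colouring T) (g m : R) :
  ~~ has_copy (colour_class G phi true) (complete 3) ->
  (alpha G)%:R <= g -> 0 < m ->
  exists W : {set T},
    (forall v, #|[set x in W | [set v; x] \in edges (colour_class G phi true)]|%:R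
       * m <= #|W|%:R * g) /\
    (forall A : {set T}, A \subset ~: W -> m <= #|A|%:R ->
       exists u v, [/\ u \in A, v \in A &
         [set u; v] \in edges (colour_class G phi false)]).
Proof.
move=> notri Ga m0; set G1 := colour_class G phi true in notri *.
set G2 := colour_class G phi false.
pose N v (A : {set T}) := [set x in A | [set v; x] \in edges G1].
pose P (W : {set T}) := [forall v, #|N v W|%:R * m <= #|W|%:R * g].
have P0 : P set0.
  apply/forallP => v; rewrite cards0 mul0r (_ : N v set0 = set0) ?cards0 ?mul0r //.
  by apply/setP => x; rewrite !inE.
have [W /maxsetP[/forallP PW maxW] _] := maxset_exists P0.
exists W; split=> // A AW mA.
have [/existsP[u /existsP[v /and3P[uA vA uv]]]|no2] :=
  boolP [exists u, exists v, [&& u \in A, v \in A & [set u; v] \in edges G2]].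
  by exists u, v.
exfalso; have indepN v : independent G (N v A).
  apply/forall_inP => e eG; apply/negP => eN.
  have /cards2P[x [y [xy eE]]] := forall_inP (edges_card2 G) e eG.
  have : x \in N v A by rewrite (subsetP eN) // eE !inE eqxx.
  have : y \in N v A by rewrite (subsetP eN) // eE !inE eqxx orbT.
  rewrite !inE => /andP[yA /andP[vy1 vy2]] /andP[xA /andP[vx1 vx2]].
  have [e1|e2] := boolP (phi e).
    move/negP: notri; apply; apply: (@has_copy_triangle _ _ v x y);
      by rewrite in_colour_class ?vx1 ?vy1 // -eE eG e1.
  move/negP: no2; apply; apply/existsP; exists x; apply/existsP; exists y.
  by rewrite xA yA -eE in_colour_class eG (negbTE e2).
(* [A] adds at most [g] to each count on the left and at least [m] to the size on the right, so the
   union still satisfies [P], against the maximality of [W]. *)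
have PWA : P (W :|: A).
  apply/forallP => v.
  have -> : N v (W :|: A) = N v W :|: N v A.
    by apply/setP => x; rewrite !inE andb_orl.
  have dWA : [disjoint W & A] by rewrite disjoint_sym disjoints_subset.
  have -> : #|W :|: A|%:R = #|W|%:R + #|A|%:R :> R.
    by rewrite -natrD cardsU (disjoint_setI0 dWA) cards0 subn0.
  have h1 : #|N v W :|: N v A|%:R <= #|N v W|%:R + #|N v A|%:R :> R.
    by rewrite -natrD ler_nat cardsU leq_subr.
  have h2 : #|N v A|%:R <= g.
    by apply: le_trans Ga; rewrite ler_nat (leq_bigmax_cond (F := fun A : {set T} => #|A|)).
  have g0 : 0 <= g by apply: le_trans Ga.
  have := PW v; have := ler_wpM2r (ltW m0) h1; have := ler_wpM2r (ltW m0) h2.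
  by have := ler_wpM2r g0 mA; rewrite -/(N v W) -/N; lra.
have := maxW _ PWA (subsetUl _ _) => /setUidPl AsubW.
have A0 : A = set0.
  apply/setP => x; rewrite inE; apply/negP => xA.
  by have := subsetP AW x xA; rewrite inE (subsetP AsubW).
by move: mA; rewrite A0 cards0 leNgt m0.
Qed.

Lemma card_le_sum_cover (I Y : finType) (K : {set Y}) (F : I -> {set Y}) :
  (forall y, y \in K -> exists i, y \in F i) -> (#|K| <= \sum_i #|F i|)%N.
Proof.
move=> KF; have -> : (\sum_i #|F i| = \sum_y \sum_i (y \in F i))%N.
  rewrite exchange_big /=; apply: eq_bigr => i _.
  by rewrite -sum1_card big_mkcond; apply: eq_bigr => y _; case: (y \in F i).
rewrite -sum1_card big_mkcond /=; apply: leq_sum => y _.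
by case: ifP => // /KF[i yi]; rewrite (bigD1 i) //= yi.
Qed.

(** The edge hypothesis is the Turan density for [r]-cliques, a surplus [eta / (r.-1)%:R], and a
    term paying for the ordered pairs of colour 1 with an end in [W], at most [#|T|^2 g / m] for
    each end. The sequence [d] gives the densities kept during the successive doublings. *)
Lemma second_colour_clique (R : realFieldType) (T : finType) (G : sgraph T)
    (phi : colouring T) (N s r p : nat) (eta g m : R) (d : nat -> R)
    (q : nat -> nat) :
  arrows 3 s N ->
  (r = N /\ p = 2 * s - 1 \/ r = N.+1 /\ p = 2 * s)%N ->
  (2 <= r)%N -> (0 < #|T|)%N ->
  ~~ has_copy (colour_class G phi true) (complete 3) ->
  (alpha G)%:R <= g -> 0 < m -> 0 < eta -> eta <= 1 ->
  (forall a, 0 < d a) ->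
  (forall a, (a < s)%N ->
     m <= #|T|%:R * d a.+1 ^+ q a - #|T|%:R ^+ 3 * d a ^+ q a) ->
  (forall a, (a <= s)%N -> d a <= eta ^+ r.-1 / 4 ^+ r) ->
  (1 - (1 - eta) / (r.-1)%:R) * #|T|%:R ^+ 2 + 2 * (#|T|%:R ^+ 2 * (g / m))
    <= 2 * #|edges G|%:R ->
  has_copy (colour_class G phi false) (complete p).
Proof.
move=> arr rp r2 T0 notri Ga m0 eta0 eta1 d0 dq ds HG.
have [W [W1 W2]] := first_colour_part notri Ga m0.
set G1 := colour_class G phi true in notri W1.
set G2 := colour_class G phi false in W2 *.
pose e1 x y := [set x; y] \in edges G1.
pose e2 x y := [set x; y] \in edges G2.
have e1C : symmetric e1 by move=> x y; rewrite /e1 setUC.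
have e2C : symmetric e2 by move=> x y; rewrite /e2 setUC.
pose adj x y := e2 x y || [&& e1 x y, x \notin W & y \notin W].
have adjC : symmetric adj by move=> x y; rewrite /adj e2C e1C [(x \notin W) && _]andbC.
have T0' : 0 < #|T|%:R :> R by rewrite ltr0n.
have dens : (1 - (1 - eta) / (r.-1)%:R) * #|T|%:R ^+ 2 <= \sum_v \sum_w (adj v w)%:R.
  have sW : \sum_v \sum_w (e1 v w && (w \in W))%:R <= #|T|%:R ^+ 2 * (g / m).
    have -> : #|T|%:R ^+ 2 * (g / m) = \sum_(v : T) (#|T|%:R * (g / m)).
      by rewrite sumr_const -[RHS]mulr_natl expr2 -mulrA.
    apply: ler_sum => v _; rewrite mulrA ler_pdivlMr //.
    have g0 : 0 <= g by apply: le_trans Ga.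
    apply: le_trans (@le_trans _ _ (#|W|%:R * g) _ _ _ _); last first.
    - by rewrite ler_wpM2r // ler_nat max_card.
    - exact: (W1 v).
    rewrite ler_wpM2r ?(ltW m0) // -natr_sum ler_nat -sum1_card [leqRHS]big_mkcond /=.
    by apply: leq_sum => w _; rewrite inE andbC; case: (_ && _).
  have sW' : \sum_v \sum_w (e1 v w && (v \in W))%:R <= #|T|%:R ^+ 2 * (g / m).
    apply: le_trans sW; rewrite exchange_big /= le_eqVlt; apply/orP; left.
    by apply/eqP; apply: eq_bigr => v _; apply: eq_bigr => w _; rewrite e1C.
  have : \sum_v \sum_w ([set v; w] \in edges G)%:R <= \sum_v \sum_w (adj v w)%:R +
     (\sum_v \sum_w (e1 v w && (w \in W))%:R + \sum_v \sum_w (e1 v w && (v \in W))%:R) :> R.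
    rewrite -!big_split /=; apply: ler_sum => v _; rewrite -!big_split /=.
    apply: ler_sum => w _; rewrite -!natrD ler_nat /adj /e1 /e2 !in_colour_class.
    by case: (_ \in edges G); case: (phi _); case: (v \in W); case: (w \in W).
  by rewrite sum_adjacent natrM; lra.
have := supersaturation adjC T0 r2 eta0 eta1 dens.
set K := [set y | _] => HK.
(* A type [(S, Q)] records the coordinates to be doubled, outside [W], and those used once, inside
   [W]. *)
pose Hst (st : {set 'I_r} * {set 'I_r}) : {set {ffun 'I_r -> T}} :=
  [set y : {ffun 'I_r -> T} | [&& [forall i in st.1, y i \notin W], [forall i in st.2, y i \in W],
    (p <= 2 * #|st.1| + #|st.2|)%N, (#|st.1| <= s)%N &
    clique_on e2 y (st.1 :|: st.2)]].
have KH y : y \in K -> exists st, y \in Hst st.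
  rewrite inE => /clique_onP yK.
  have [] := @ramsey_split N s r p (fun i j => e1 (y i) (y j))
    [set i | y i \in W] arr _ rp.
  - by move=> i j; rewrite e1C.
  - move=> f Hf; move/negP: notri; apply.
    apply: (@has_copy_complete _ _ _ [set: 'I_3] (fun a => y (f a))).
      by rewrite cardsT card_ord.
    by move=> a b _ _ ab; have [] := Hf a b ab.
  move=> S [S1 S2 S3 S4]; exists (S, [set i | y i \in W]).
  have SW i : i \in S -> y i \notin W.
    by move=> iS; have /pred0P/(_ i) := S1; rewrite !inE /= iS /= => ->.
  rewrite inE S3 S4 /=; apply/and3P; split.
  - by apply/forall_inP.
  - by apply/forall_inP => i; rewrite inE.
  apply/clique_onP => i j; rewrite !inE => iS jS ij.
  have := yK i j (in_setT _) (in_setT _) ij; rewrite /adj => /orP[//|/and3P[e1ij iW jW]].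
  move: iS jS; rewrite (negbTE iW) (negbTE jW) !orbF => iS jS.
  by have := S2 i j iS jS ij; rewrite e1ij.
set Om : R := #|{ffun 'I_r -> T}|%:R in HK.
have Om0 : 0 < Om.
  have /card_gt0P[t _] := T0.
  by rewrite ltr0n; apply/card_gt0P; exists [ffun=> t].
(* Pigeonhole over the [4 ^ r] pairs of subsets of the coordinates. *)
have [st Hs] : exists st, eta ^+ r.-1 / 4 ^+ r * Om <= #|Hst st|%:R.
  apply/existsP/contraT => /existsPn H; exfalso.
  have : #|K|%:R <= \sum_st #|Hst st|%:R :> R.
    by rewrite -natr_sum ler_nat; exact: card_le_sum_cover.
  suff : \sum_st #|Hst st|%:R < eta ^+ r.-1 * Om by move: HK; lra.
  have -> : eta ^+ r.-1 * Om =
      \sum_(st : {set 'I_r} * {set 'I_r}) (eta ^+ r.-1 / 4 ^+ r * Om).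
    rewrite sumr_const card_prod -!cardsT -!powersetT !card_powerset cardsT card_ord.
    rewrite -[RHS]mulr_natl -expnMn natrX; set x := 4 ^+ r.
    rewrite mulrA [x * _]mulrC divfK //.
    by rewrite expf_neq0 // pnatr_eq0.
  rewrite (bigD1 (set0, set0)) //= [ltRHS](bigD1 (set0, set0)) //=.
  apply: ltr_leD; first by rewrite ltNge H.
  by apply: ler_sum => st _; rewrite ltW // ltNge H.
have [y0] : exists y, y \in Hst st.
  have : (0 < #|Hst st|)%N.
    rewrite -(ltr0n R); apply: lt_le_trans Hs.
    by rewrite mulr_gt0 // divr_gt0 ?exprn_gt0.
  by move=> /card_gt0P[y ?]; exists y.
case: st Hs => S Q Hs; rewrite inE /= => /and5P[/forall_inP y0S /forall_inP y0Q pS Ss _].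
have dSQ i : i \in S -> i \in Q -> False.
  by move=> /y0S /negP h /y0Q.
have [| | | |y [u [v [euv Hz]]]] := @double_coordinates R 'I_r T e2 (~: W) d q m s
  T0 m0 d0 W2 dq (enum S) (Hst (S, Q)).
- exact: enum_uniq.
- by rewrite -cardE.
- move=> y i; rewrite inE mem_enum => /and5P[/forall_inP yS _ _ _ _] iS.
  by rewrite inE yS.
- rewrite -cardE; apply: le_trans Hs; rewrite ler_wpM2r ?(ltW Om0) //.
  exact: ds.
(* The vertices of the final clique: two for each coordinate in [S], only the one labelled [true]
   for each in [Q]. *)
pose f (ib : 'I_r * bool) :=
  if ib.1 \in S then (if ib.2 then u ib.1 else v ib.1) else y ib.1.
pose J := [set ib : 'I_r * bool | (ib.1 \in S) || (ib.1 \in Q) && ib.2].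
apply: (@has_copy_complete _ _ G2 J f).
  apply: leq_trans pS _.
  have -> : J = setX S [set: bool] :|: setX Q [set true].
    by apply/setP => -[i b]; rewrite !inE /= andbT; case: b.
  rewrite cardsU !cardsX cardsT card_bool cards1 muln1 mulnC.
  rewrite (_ : _ :&: _ = set0) ?cards0 ?subn0 //.
  apply/setP => -[i b]; rewrite !inE /= andbT; apply/negbTE/negP.
  by move=> /andP[iS /andP[iQ _]]; exact: (dSQ i).
move=> [i b] [j c] iJ jJ ijbc; move: iJ jJ; rewrite ![_ \in J]inE /= => iJ jJ.
have [ij|ij] := eqVneq i j; last first.
  (* Two vertices at different coordinates occur together in one tuple [z] of the box, which lies in
     [Hst (S, Q)]. *)
  pose z : {ffun 'I_r -> T} := [ffun k => if k \in S then
     (if k == i then f (i, b) else if k == j then f (j, c) else u k) else y k].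
  have : z \in Hst (S, Q).
    apply: Hz => k; rewrite mem_enum => kS; last by rewrite ffunE (negbTE kS).
    rewrite ffunE kS /f /=; case: eqP => [ki|_].
      by rewrite -ki kS; case: (b); [left|right].
    case: eqP => [kj|_]; last by left.
    by rewrite -kj kS; case: (c); [left|right].
  rewrite inE => /and5P[_ _ _ _ /clique_onP /= cz].
  have zi : z i = f (i, b).
    by rewrite ffunE eqxx /f /=; case: (i \in S).
  have zj : z j = f (j, c).
    by rewrite ffunE eqxx eq_sym (negbTE ij) /f /=; case: (j \in S).
  rewrite -zi -zj; apply: (cz i j) => //; rewrite inE.
    by case/orP: iJ => [->|/andP[->]]; rewrite ?orbT.
  by case/orP: jJ => [->|/andP[->]]; rewrite ?orbT.
subst j; have iS : i \in S.
  move: ijbc iJ jJ; case: (i \in S) => //=; rewrite xpair_eqE eqxx /=.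
  by case: b; case: c; rewrite ?andbF.
have := euv i; rewrite mem_enum => /(_ iS) ei; rewrite /f /= iS.
move: ijbc; rewrite xpair_eqE eqxx /=; case: b {iJ}; case: c {jJ} => // _.
by rewrite setUC.
Qed.

(** * Triangle-free graphs with small independence number *)

Definition pairs (T : finType) (t : {set T}) : {set {set T}} :=
  [set e : {set T} | e \subset t & #|e| == 2].

(** A triangle is its set of three edges, so that [trivIset] says edge-disjoint and [cover] is the
    set of edges used. *)
Definition is_triangle (T : finType) (A : {set {set T}}) : bool :=
  [exists t : {set T}, (#|t| == 3) && (A == pairs t)].

Definition triangles_at (T : finType) (S : {set T}) : {set {set {set T}}} :=
  [set pairs t | t : {set T} & (#|t| == 3) && (2 <= #|t :&: S|)%N].

Lemma card_triangles_at (T : finType) (S : {set T}) :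
  (#|triangles_at S| <= #|S| ^ 2 * #|T|)%N.
Proof.
have -> : (#|S| ^ 2 * #|T| = #|setX (setX S S) [set: T]|)%N.
  by rewrite !cardsX cardsT mulnn.
apply: leq_trans (leq_imset_card (fun p : T * T * T => pairs [set p.1.1; p.1.2; p.2]) _).
apply: subset_leq_card; apply/subsetP => _ /imsetP[t + ->].
rewrite inE => /andP[t3 tS].
have /card_gt1P[x [y [xtS ytS xy]]] : (1 < #|t :&: S|)%N by [].
move: xtS ytS; rewrite !inE => /andP[xt xS] /andP[yt yS].
have : (0 < #|t :\ x :\ y|)%N.
  move: t3; rewrite (cardsD1 x) xt (cardsD1 y (t :\ x)) !inE [y == x]eq_sym xy yt /=.
  by rewrite !add1n !eqSS => /eqP ->.
move=> /card_gt0P[z]; rewrite !inE => /and3P[zy zx zt].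
apply/imsetP; exists (x, y, z) => /=; first by rewrite !inE /= xS yS.
congr pairs; apply/esym/eqP; rewrite eqEcard (eqP t3); apply/andP; split.
  by apply/subsetP => w; rewrite !inE => /orP[/orP[]|] /eqP->.
by rewrite -setUA cardsU1 cards2 !inE negb_or xy [x == z]eq_sym [y == z]eq_sym zx zy.
Qed.

(** Probability of [f] when every set of vertices is chosen independently with probability [p]; sets
    that are not pairs are chosen too, which is harmless as their factors sum to 1. *)
Definition edge_weight (R : realFieldType) (T : finType) (p : R)
    (f : colouring T) : R := \prod_e (if f e then p else 1 - p).

Lemma edge_weight_ge0 (R : realFieldType) (T : finType) (p : R) (f : colouring T) :
  0 <= p -> p <= 1 -> 0 <= edge_weight p f.
Proof.
by move=> p0 p1; apply: prodr_ge0 => e _; case: ifP => // _; rewrite subr_ge0.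
Qed.

Lemma edge_weight_cylinder (R : realFieldType) (T : finType) (p : R)
    (A B : {set {set T}}) : [disjoint A & B] ->
  \sum_(f : colouring T | [forall e in A, f e] && [forall e in B, ~~ f e])
     edge_weight p f = p ^+ #|A| * (1 - p) ^+ #|B|.
Proof.
move=> dAB; pose Q e b := ((e \in A) ==> b) && ((e \in B) ==> ~~ b).
transitivity (\prod_e \sum_(b | Q e b) (if b then p else 1 - p)).
  rewrite bigA_distr_big_dep; apply: eq_bigl => f.
  apply/andP/familyP => [[/forall_inP fA /forall_inP fB] e|fQ].
    apply/andP; split; apply/implyP; [exact: fA|exact: fB].
  split; apply/forall_inP => e eAB; have := fQ e; rewrite unfold_in /Q eAB.
    by case/andP.
  by case/andP => _ /implyP; apply.
transitivity (\prod_e ((if e \in A then p else 1) * (if e \in B then 1 - p else 1))).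
  apply: eq_bigr => e _; rewrite big_mkcond big_bool /Q /=.
  have := disjointFr dAB (x := e); case: (e \in A) => [/(_ isT) ->|_] /=.
    by rewrite addr0 mulr1.
  by case: (e \in B); rewrite /= ?add0r ?mul1r // addrC subrK.
by rewrite big_split /= -!big_mkcond !prodr_const.
Qed.

Lemma sum_edge_weight (R : realFieldType) (T : finType) (p : R) :
  \sum_(f : colouring T) edge_weight p f = 1.
Proof.
transitivity (p ^+ #|(set0 : {set {set T}})| * (1 - p) ^+ #|(set0 : {set {set T}})|).
  rewrite -edge_weight_cylinder; last by rewrite -setI_eq0 set0I.
  apply: eq_bigl => f; apply/esym/andP.
  by split; apply/forall_inP => e; rewrite inE.
by rewrite cards0 !expr0 mulr1.
Qed.

Lemma sum_subsets_pow (R : realFieldType) (I : finType) (A : {set I}) (x : R) :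
  0 <= x -> \sum_(J : {set I} | J \subset A) x ^+ #|J| <= (1 + x) ^+ #|A|.
Proof.
move=> x0; have -> : (1 + x) ^+ #|A| = \prod_i ((if i \in A then x else 0) + 1).
  rewrite -prodr_const big_mkcond; apply: eq_bigr => i _.
  by case: ifP; rewrite ?add0r // addrC.
rewrite bigA_distr [leLHS]big_mkcond [leRHS]big_mkcond; apply: ler_sum => J _ /=.
case: ifP => [JA|_]; last by rewrite prodr_ge0 // => i _; do !case: ifP.
rewrite -prodr_const big_mkcond /= le_eqVlt; apply/orP; left; apply/eqP.
by apply: eq_bigr => i _; case: ifP => // /(subsetP JA) ->.
Qed.

(* A colour class f (the random graph) is bad for S when edge-disjoint triangles
   of f cover all of its edges inside S: only then can S become independent after
   the removal of a maximal family of edge-disjoint triangles. *)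
Definition covered (T : finType) (S : {set T}) (f : colouring T)
    (F : {set {set {set T}}}) : bool :=
  [&& F \subset triangles_at S, trivIset F, [forall e in cover F, f e] &
      [forall e in pairs S :\: cover F, ~~ f e]].

Lemma card_pairs (T : finType) (t : {set T}) : #|pairs t| = 'C(#|t|, 2).
Proof. exact: cards_draws. Qed.

(** Union bound over [F]. For fixed [F], [3 * #|F|] edges are present and all other pairs in [S]
    absent; as [1 - p >= 1 / 2], this has probability at most [(1 - p) ^+ 'C(#|S|, 2)] times
    [(2 p) ^+ (3 * #|F|)]. The sum over [F] is then bounded by a binomial expansion. *)
Lemma covered_weight (R : realFieldType) (T : finType) (p : R) (S : {set T}) :
  0 <= p -> p <= 1 / 2 ->
  \sum_(f : colouring T | [exists F, covered S f F]) edge_weight p f <=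
  (1 - p) ^+ 'C(#|S|, 2) * (1 + 8 * p ^+ 3) ^+ (#|S| ^ 2 * #|T|).
Proof.
move=> p0 p2; have p1 : 0 < 1 - p by lra.
have w0 (f : colouring T) : 0 <= edge_weight p f by apply: edge_weight_ge0 => //; lra.
apply: (@le_trans _ _ (\sum_(F : {set {set {set T}}})
    \sum_(f | covered S f F) edge_weight p f)).
  rewrite (exchange_big_dep predT) //= [leLHS]big_mkcond /=.
  apply: ler_sum => f _; case: ifP => [/existsP[F cF]|_].
    by rewrite (bigD1 F) //= lerDl sumr_ge0.
  by apply: sumr_ge0.
have sx : \sum_(F : {set {set {set T}}} | F \subset triangles_at S)
    (1 - p) ^+ 'C(#|S|, 2) * (8 * p ^+ 3) ^+ #|F| <=
    (1 - p) ^+ 'C(#|S|, 2) * (1 + 8 * p ^+ 3) ^+ (#|S| ^ 2 * #|T|).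
  rewrite -big_distrr /= ler_wpM2l ?exprn_ge0 ?(ltW p1) //.
  have x0 : 0 <= 8 * p ^+ 3 by rewrite mulr_ge0 ?exprn_ge0.
  apply: le_trans (sum_subsets_pow _ x0) _.
  by apply: ler_weXn2l; [rewrite lerDl|exact: card_triangles_at].
apply: le_trans sx.
rewrite [leRHS]big_mkcond /=; apply: ler_sum => F _.
have [FS|FS] := boolP (F \subset _); last first.
  by rewrite big_pred0 // => f; rewrite /covered (negbTE FS).
have [tF|tF] := boolP (trivIset F); last first.
  rewrite big_pred0; last by move=> f; rewrite /covered (negbTE tF) andbF.
  by rewrite mulr_ge0 ?exprn_ge0 ?mulr_ge0 ?exprn_ge0 // ltW.
have cF : #|cover F| = (3 * #|F|)%N.
  rewrite -(eqnP tF) mulnC -sum_nat_const; apply: eq_bigr => A AF.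
  have /imsetP[t + ->] := subsetP FS A AF; rewrite inE => /andP[/eqP t3 _].
  by rewrite card_pairs t3.
under eq_bigl do rewrite /covered FS tF /=.
rewrite edge_weight_cylinder; last first.
  by rewrite disjoints_subset setCD setUC; apply/subsetP => e eF; rewrite inE eF.
rewrite cF; set B := pairs S :\: cover F.
have cB : ('C(#|S|, 2) <= #|B| + 3 * #|F|)%N.
  rewrite -card_pairs -cF -(cardsID (cover F) (pairs S)) addnC leq_add2l.
  exact: subset_leq_card (subsetIr _ _).
have h2 a b : (b <= a)%N -> (1 - p) ^+ a <= (1 - p) ^+ b.
  by apply: ler_wiXn2l; lra.
have h1 : 1 <= (2 * (1 - p)) ^+ (3 * #|F|) by rewrite exprn_ege1 //; lra.
have -> : (8 * p ^+ 3) ^+ #|F| = 2 ^+ (3 * #|F|) * p ^+ (3 * #|F|).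
  by rewrite -exprMn [RHS]exprM exprMn; congr ((_ * _) ^+ _); ring.
rewrite mulrA mulrC ler_wpM2r ?exprn_ge0 //.
apply: (@le_trans _ _ ((1 - p) ^+ #|B| * (2 * (1 - p)) ^+ (3 * #|F|))).
  by rewrite ler_peMr // exprn_ge0 // ltW.
by rewrite exprMn mulrCA mulrC -exprD ler_wpM2r ?exprn_ge0 // h2.
Qed.

(** By the union bound some [f] is covered on no [k]-set. Deleting a maximal family of edge-disjoint
    triangles kills all triangles, and a [k]-set made independent by it would have been covered. *)
Lemma exists_triangle_free (R : realFieldType) (T : finType) (k : nat) (p : R) :
  0 <= p -> p <= 1 / 2 ->
  'C(#|T|, k)%:R *
    ((1 - p) ^+ 'C(k, 2) * (1 + 8 * p ^+ 3) ^+ (k ^ 2 * #|T|)) < 1 ->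
  exists F : sgraph T, ~~ has_copy F (complete 3) /\
    forall S : {set T}, #|S| = k -> ~~ independent F S.
Proof.
move=> p0 p2 Hp.
have w0 (f : colouring T) : 0 <= edge_weight p f by apply: edge_weight_ge0 => //; lra.
have [f Hf] : exists f : colouring T, forall S : {set T}, #|S| = k ->
    ~~ [exists F, covered S f F].
  have [f Hf|nof] := pickP (fun f : colouring T =>
      [forall S : {set T}, (#|S| == k) ==> ~~ [exists F, covered S f F]]).
    by exists f => S Sk; move/forallP/(_ S): Hf; rewrite Sk eqxx.
  exfalso; move: Hp; apply/negP; rewrite -leNgt -[leLHS](sum_edge_weight T p).
  apply: (@le_trans _ _ (\sum_(S : {set T} | #|S| == k)
    \sum_(f : colouring T | [exists F, covered S f F]) edge_weight p f)).
    rewrite (exchange_big_dep predT) //=; apply: ler_sum => f _.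
    have := negbT (nof f); rewrite negb_forall => /existsP[S].
    rewrite negb_imply negbK => cS.
    by rewrite (bigD1 S) //= lerDl sumr_ge0.
  have cE : #|[set S : {set T} | #|S| == k]| = 'C(#|T|, k).
    by rewrite -cardsT -cards_draws; apply: eq_card => S; rewrite !inE subsetT.
  rewrite -cE mulr_natl -sumr_const [leRHS]big_mkcond [leLHS]big_mkcond /=.
  apply: ler_sum => S _; rewrite inE; case: eqP => // Sk.
  by rewrite -Sk; exact: covered_weight.
pose P (F : {set {set {set T}}}) :=
  [&& [forall A in F, is_triangle A], trivIset F & [forall e in cover F, f e]].
have P0 : P set0.
  apply/and3P; split.
  - by apply/forall_inP => A; rewrite inE.
  - by apply/trivIsetP => A B; rewrite inE.
  - by apply/forall_inP => e; rewrite /cover big_set0 inE.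
have [F /maxsetP[/and3P[/forall_inP Ftri Ftriv /forall_inP Ff] Fmax] _] :=
  maxset_exists P0.
have Gc : [forall e in [set e : {set T} | [&& #|e| == 2, f e & e \notin cover F]],
    #|e| == 2].
  by apply/forall_inP => e; rewrite inE => /and3P[].
exists (SGraph Gc); split.
  apply/negP => /copy_complete_edges[h hE].
  pose t := [set h a | a : 'I_3].
  have hinj : injective h.
    move=> a b hab; apply/eqP/negPn/negP => /hE/edge_neq.
    by rewrite hab eqxx.
  have tE e : e \in pairs t -> f e /\ e \notin cover F.
    rewrite inE => /andP[et /cards2P[x [y [xy eE]]]].
    have : x \in t by rewrite (subsetP et) // eE !inE eqxx.
    have : y \in t by rewrite (subsetP et) // eE !inE eqxx orbT.
    move=> /imsetP[b _ yE] /imsetP[a _ xE].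
    have ab : a != b by apply: contra_neq xy => ab; rewrite xE yE ab.
    by have := hE a b ab; rewrite -xE -yE -eE inE => /and3P[].
  have t3 : #|t| = 3 by rewrite card_imset // card_ord.
  have PF : P (pairs t |: F).
    apply/and3P; split.
    - apply/forall_inP => A /setU1P[->|/Ftri //].
      by apply/existsP; exists t; rewrite t3 !eqxx.
    - apply/trivIsetP => A B; have dis C : C \in F -> [disjoint pairs t & C].
        move=> CF; rewrite disjoints_subset; apply/subsetP => e /tE[_ eF].
        by rewrite inE; apply: contra eF => eC; apply/bigcupP; exists C.
      move=> /setU1P[->|AF] /setU1P[->|BF]; rewrite ?eqxx // => AB.
      + exact: dis.
      + by rewrite disjoint_sym; exact: dis.
      + exact: (trivIsetP Ftriv).
    apply/forall_inP => e /bigcupP[A /setU1P[->|AF] eA]; first by have [] := tE e eA.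
    by apply: Ff; apply/bigcupP; exists A.
  (* Maximality puts the surviving triangle into the deleted family, although its edges avoid
     [cover F]. *)
  have Ft : pairs t \in F by rewrite -(Fmax _ PF (subsetUr _ _)) setU11.
  have /card_gt0P[e et] : (0 < #|pairs t|)%N by rewrite card_pairs t3.
  have [_ /negP] := tE e et; apply; apply/bigcupP; by exists (pairs t).
move=> S Sk; apply: contra (Hf S Sk) => /forall_inP indS.
(* Only deleted triangles with an edge inside [S] matter for the pairs in [S]. *)
apply/existsP; exists (F :&: triangles_at S); apply/and4P; split.
- exact: subsetIr.
- by apply: trivIsetS Ftriv; exact: subsetIl.
- apply/forall_inP => e /bigcupP[A /setIP[AF _] eA].
  by apply: Ff; apply/bigcupP; exists A.
apply/forall_inP => e; rewrite !inE => /andP[ecov /andP[eS e2]].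
apply/negP => fe; have [eF|eF] := boolP (e \in cover F); last first.
  by have := indS e; rewrite inE e2 fe eF eS => /(_ isT).
move/negP: ecov; apply; have /bigcupP[A AF eA] := eF.
apply/bigcupP; exists A => //; rewrite inE AF /=.
have /existsP[t /andP[t3 /eqP At]] := Ftri A AF.
move: eA; rewrite At inE => /andP[et _].
have etS : e \subset t :&: S by rewrite subsetI et.
have := subset_leq_card etS; rewrite (eqP e2) => tS.
by apply: imset_f; rewrite inE t3 tS.
Qed.

(** * Lower bound *)

Definition colouring_of (T : finType) (rho : rel T) : colouring T :=
  [ffun e => [exists x, exists y, [&& e == [set x; y], x != y & rho x y]]].

Lemma colouring_ofE (T : finType) (rho : rel T) (x y : T) :
  symmetric rho -> x != y -> colouring_of rho [set x; y] = rho x y.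
Proof.
move=> rhoC xy; rewrite ffunE; apply/existsP/idP => [[a /existsP[b]]|rxy].
  by move=> /and3P[/eqP /set2_inj/(_ xy)[[-> ->]|[-> ->]] _] //; rewrite rhoC.
by exists x; apply/existsP; exists y; rewrite eqxx xy rxy.
Qed.

(* The part None plays the role of the extra part, whose inner edges get the
   first colour and whose outer edges all get the second colour. *)
Lemma blowup_free (T : finType) (F : sgraph T) (M s p : nat)
    (part : T -> option 'I_M) :
  ~~ arrows 3 s M -> (0 < s)%N ->
  (p = 2 * s - 1 /\ (forall x, part x != None) \/ p = 2 * s)%N ->
  ~~ has_copy F (complete 3) ->
  exists G : sgraph T, [/\ free2 (complete 3) (complete p) G,
    (alpha G <= alpha F)%N &
    forall x y, part x != part y -> [set x; y] \in edges G].
Proof.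
rewrite /arrows negb_forall => /existsP[psi]; rewrite negb_or => /andP[psi3 psis].
move=> s0 hp F3.
pose cross : colouring T := colouring_of (fun x y => part x != part y).
have crossE x y : x != y -> cross [set x; y] = (part x != part y).
  by move=> xy; rewrite colouring_ofE // => a b; rewrite eq_sym.
pose kap x y := match part x, part y with
  | Some i, Some j => (i != j) && psi [set i; j]
  | None, None => true
  | _, _ => false end.
have kapC : symmetric kap.
  by move=> x y; rewrite /kap; case: (part x) (part y) => [i|] [j|] //;
    rewrite eq_sym setUC.
have Gc : [forall e in [set e : {set T} |
    (#|e| == 2) && ((e \in edges F) || cross e)], #|e| == 2].
  by apply/forall_inP => e; rewrite inE => /andP[].
pose G := SGraph Gc; exists G.
have inner x y : [set x; y] \in edges G -> part x = part y -> [set x; y] \in edges F.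
  move=> xy pxy; have nxy := edge_neq xy.
  by move: xy; rewrite inE crossE // pxy eqxx orbF => /andP[].
split; last 1 first.
- move=> x y pxy; have nxy : x != y by apply: contraNneq pxy => ->.
  by rewrite inE cards2 nxy crossE // pxy orbT.
- apply/existsP; exists (colouring_of kap); apply/andP; split.
    apply/negP => /copy_complete_edges[f fE].
    have kE a b : a != b -> [set f a; f b] \in edges G /\ kap (f a) (f b).
      move=> /fE; rewrite in_colour_class => /andP[fG].
      by rewrite colouring_ofE ?(edge_neq fG) // => /eqP.
    case p0 : (part (f ord0)) => [i0|].
      have pS a : part (f a) != None.
        have [->|a0] := eqVneq a ord0; first by rewrite p0.
        by have [_] := kE _ _ a0; rewrite /kap p0; case: (part (f a)).
      pose g a := odflt i0 (part (f a)).
      have gE a : part (f a) = Some (g a).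
        by rewrite /g; have := pS a; case: (part (f a)).
      move/negP: psi3; apply.
      apply: (@has_copy_complete _ _ _ [set: 'I_3] g); first by rewrite cardsT card_ord.
      move=> a b _ _ ab; have [_] := kE a b ab; rewrite /kap !gE => /andP[gab psiab].
      by rewrite in_colour_class inE cards2 gab psiab.
    have pN a : part (f a) = None.
      have [->//|a0] := eqVneq a ord0.
      by have [_] := kE _ _ a0; rewrite /kap p0; case: (part (f a)).
    move/negP: F3; apply.
    apply: (@has_copy_complete _ _ _ [set: 'I_3] f); first by rewrite cardsT card_ord.
    by move=> a b _ _ ab; have [fG _] := kE a b ab; apply: inner => //; rewrite !pN.
  apply/negP => /copy_complete_edges[f fE].
  have kE a b : a != b -> [set f a; f b] \in edges G /\ ~~ kap (f a) (f b).
    move=> /fE; rewrite in_colour_class => /andP[fG].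
    by rewrite colouring_ofE ?(edge_neq fG) // => /eqP ->.
  (* A second-colour clique has at most one vertex in the extra part, at most two in any other since
     [F] is triangle-free, and meets fewer than [s] of those since [psi] has no second-colour clique
     of size [s]. This totals less than [p]. *)
  pose N := [set a | part (f a) == None].
  pose Fib i := [set a | part (f a) == Some i].
  pose I := [set i | Fib i != set0].
  have cN : (#|N| + 2 * s <= p + 1)%N.
    have N1 : (#|N| <= 1)%N.
      rewrite leqNgt; apply/negP => /card_gt1P[a [b [aN bN ab]]].
      move: aN bN; rewrite !inE => /eqP aN /eqP bN.
      by have [_] := kE a b ab; rewrite /kap aN bN.
    case: hp => [[pE noN]|pE]; last by lia.
    rewrite (_ : N = set0) ?cards0; first by lia.
    by apply/setP => a; rewrite !inE; apply/negbTE.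
  have cFib i : (#|Fib i| <= 2 * (i \in I))%N.
    rewrite inE; have [->|_] := eqVneq (Fib i) set0; first by rewrite cards0.
    rewrite muln1 leqNgt; apply/negP => /card_gt2P[a [b [c [[aF bF cF] [ab bc ca]]]]].
    move: aF bF cF; rewrite !inE => /eqP aF /eqP bF /eqP cF.
    move/negP: F3; apply; apply: (@has_copy_triangle _ _ (f a) (f b) (f c)).
    - by apply: inner; rewrite ?aF ?bF //; have [] := kE a b ab.
    - by apply: inner; rewrite ?aF ?cF //; rewrite setUC; have [] := kE c a ca.
    - by apply: inner; rewrite ?bF ?cF //; have [] := kE b c bc.
  have cI : (#|I| < s)%N.
    rewrite ltnNge; apply/negP => sI; move/negP: psis; apply.
    apply: (@has_copy_complete _ _ _ I id _ sI) => i j.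
    rewrite !inE => /set0Pn[a] + /set0Pn[b] + ij; rewrite !inE => /eqP ai /eqP bj.
    have ab : a != b.
      by apply: contra_neq ij => ab; move: ai; rewrite ab bj => -[].
    have [_] := kE a b ab; rewrite /kap ai bj ij /= => nij.
    by rewrite cards2 ij (negbTE nij).
  have : (#|~: N| <= \sum_i #|Fib i|)%N.
    apply: card_le_sum_cover => a; rewrite !inE.
    by case pa : (part (f a)) => [i|] // _; exists i; rewrite inE pa.
  have : (\sum_i #|Fib i| <= 2 * #|I|)%N.
    rewrite -sum1_card [X in (_ <= 2 * X)%N]big_mkcond big_distrr /=.
    apply: leq_sum => i _.
    by have := cFib i; case: (i \in I).
  by have := cardsC N; rewrite card_ord; lia.
- apply/bigmax_leqP => A /forall_inP indA.
  apply: (leq_bigmax_cond (F := fun A : {set T} => #|A|)).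
  apply/forall_inP => e eF; apply: indA; rewrite inE eF andbT.
  exact: (forall_inP (edges_card2 F)).
Qed.

Lemma card_residue_class (n P a : nat) : (0 < P)%N ->
  (#|[set w : 'I_n | w %% P == a]| <= n %/ P + 1)%N.
Proof.
move=> P0; pose h (w : 'I_n) : 'I_(n %/ P).+1 := inord (w %/ P).
rewrite addn1 -[X in (_ <= X)%N]card_ord -(card_in_imset (f := h)) ?max_card //.
move=> v w; rewrite !inE => /eqP va /eqP wa /(congr1 val) /=.
have hw (x : 'I_n) : (x %/ P < (n %/ P).+1)%N by rewrite ltnS leq_div2r // ltnW.
rewrite !inordK // => vw; apply: ord_inj.
by rewrite (divn_eq v P) (divn_eq w P) vw va wa.
Qed.

Lemma ramsey_turan_lower (R : realFieldType) (n M s p P : nat) (F : sgraph 'I_n) :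
  ~~ arrows 3 s M -> (0 < s)%N -> (0 < P)%N ->
  (P = M /\ p = 2 * s - 1 \/ P = M.+1 /\ p = 2 * s)%N ->
  ~~ has_copy F (complete 3) ->
  exists G : sgraph 'I_n, [/\ free2 (complete 3) (complete p) G,
    (alpha G <= alpha F)%N &
    (1 - 1 / P%:R) * n%:R ^+ 2 - n%:R <= 2 * #|edges G|%:R :> R].
Proof.
move=> arr s0 P0 hp F3.
(* Residues below [M] are the ordinary parts; when [P = M.+1], the residue [M] becomes [None], the
   extra part. *)
pose part (x : 'I_n) : option 'I_M := insub (x %% P)%N.
have partE x y : part x = part y -> (x %% P = y %% P)%N.
  have lt z : (z %% P < P)%N by rewrite ltn_mod.
  rewrite /part; case: insubP => [i xM iE|xM]; case: insubP => [j yM jE|yM] //.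
    by move=> [ij]; rewrite -iE -jE ij.
  move=> _; have := lt x; have := lt y; move: xM yM; rewrite -!leqNgt.
  by case: hp => -[-> _]; lia.
have [|G [G1 G2 G3]] := @blowup_free _ F M s p part arr s0 _ F3.
  case: hp => [[PM ->]|[_ ->]]; [left; split=> // x|by right].
  by rewrite /part insubT //= -PM ltn_mod.
exists G; split=> //.
have P0' : 0 < P%:R :> R by rewrite ltr0n.
have : \sum_(v : 'I_n) \sum_(w : 'I_n) (part v != part w)%:R <=
    \sum_v \sum_w ([set v; w] \in edges G)%:R :> R.
  apply: ler_sum => v _; apply: ler_sum => w _; rewrite ler_nat.
  by case: (part v =P part w) => //= /eqP/G3 ->.
rewrite sum_adjacent natrM; apply: le_trans.
apply: (@le_trans _ _ (\sum_(v < n) (n%:R - (n%:R / P%:R + 1)))).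
  rewrite sumr_const card_ord -[leRHS]mulr_natl le_eqVlt; apply/orP; left.
  by apply/eqP; field; rewrite gt_eqF.
apply: ler_sum => v _; rewrite lerBlDr.
have nE : n%:R = \sum_(w < n) (1 : R) by rewrite sumr_const card_ord.
have h : \sum_(w < n) (part v == part w)%:R <= n%:R / P%:R + 1 :> R.
  apply: (@le_trans _ _ (n %/ P + 1)%N%:R); last first.
    rewrite natrD lerD2r ler_pdivlMr // -natrM ler_nat; exact: leq_trunc_div.
  rewrite -natr_sum ler_nat; apply: leq_trans (@card_residue_class n P (v %% P)%N P0).
  rewrite -sum1_card [leqRHS]big_mkcond /=; apply: leq_sum => w _; rewrite inE.
  by case: eqP => // /partE ->; rewrite eqxx.
apply: (le_trans _ (lerD (lexx _) h)).
rewrite [leLHS]nE -big_split /=; apply: ler_sum => w _.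
by case: eqP; rewrite /= ?addr0 ?add0r.
Qed.

From mathcomp Require Import all_classical all_reals all_analysis.
Import numFieldNormedType.Exports.
Local Open Scope classical_set_scope.
Local Open Scope ring_scope.

(** * Asymptotics *)

Lemma bin_le_exp (n k : nat) : ('C(n, k) <= n ^ k)%N.
Proof.
apply: leq_trans (_ : n ^_ k <= _)%N.
  by rewrite -bin_ffact leq_pmulr // fact_gt0.
elim: k => [|k IH]; first by rewrite ffactn0 expn0.
by rewrite ffactnSr expnSr leq_mul ?leq_subr.
Qed.

Lemma near_ln_ge (R : realType) (A : R) : \forall n \near \oo, A <= ln (n%:R : R).
Proof.
near=> n; have h : expR A <= n%:R by near: n; exact: nbhs_infty_ger.
have n0 : 0 < n%:R :> R by apply: lt_le_trans h; exact: expR_gt0.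
by rewrite -ler_expR lnK.
Unshelve. all: by end_near. Qed.

Lemma powR_expR (R : realType) (n : nat) (c : R) : (0 < n)%N ->
  (n%:R : R) `^ c = expR (c * ln n%:R).
Proof. by move=> n0; rewrite /powR pnatr_eq0 gtn_eqF. Qed.

(** With [q] the square root of [n] and [p = 1 / (8 q)], the expected number of bad [k]-sets is at
    most [expR (k l - p k^2 / 4 + p k^2 / 8)], which is below 1 as soon as [p k > 8 l], that is
    [k > 64 q l]. *)
Lemma triangle_free_expR (R : realType) (n k : nat) :
  (2 <= n)%N -> (2 <= k)%N ->
  64 * expR (ln (n%:R : R) / 2) * ln n%:R < k%:R ->
  exists F : sgraph 'I_n, ~~ has_copy F (complete 3) /\ (alpha F <= k.-1)%N.
Proof.
move=> n2 k2; set l := ln _; set q := expR _ => Hk.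
have n0 : 0 < n%:R :> R by rewrite ltr0n ltnW.
have q2 : q ^+ 2 = n%:R.
  by rewrite -expRM_natl mulrCA divff ?mulr1 ?pnatr_eq0 // lnK.
have q0 : 0 < q by exact: expR_gt0.
have q1 : 1 <= q by rewrite -expR0 ler_expR divr_ge0 // ln_ge0 // ler1n ltnW.
pose p := (8 * q)^-1.
have p0 : 0 < p by rewrite invr_gt0 mulr_gt0.
have pq : p * q = 1 / 8 by rewrite /p invfM -mulrA mulVf ?gt_eqF // mulr1 div1r.
have p8 : p <= 1 / 8 by rewrite -pq ler_peMr // ltW.
have k0 : 0 < k%:R :> R by rewrite ltr0n ltnW.
have [|||F [F3 FS]] := @exists_triangle_free R 'I_n k p.
- exact: ltW.
- by lra.
- rewrite card_ord.
  have h1 : 'C(n, k)%:R <= expR (k%:R * l).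
    by rewrite expRM_natl lnK // -natrX ler_nat bin_le_exp.
  have h2 : (1 - p) ^+ 'C(k, 2) <= expR (- (p * (k%:R ^+ 2 / 4))).
    apply: (@le_trans _ _ (expR (- p) ^+ 'C(k, 2))).
      apply: lerXn2r; rewrite ?nnegrE ?expR_ge0 //; first by lra.
      exact: expR_ge1Dx.
    rewrite -expRM_natl ler_expR mulrN lerN2 mulrC ler_pM2r //.
    have : (k ^ 2 <= 4 * 'C(k, 2))%N.
      by rewrite bin2 -mulnn; case: k k2 {Hk k0 h1} => [|[|k]] // _; have := odd_double_half (k.+2 * k.+1); rewrite oddM /=; nia.
    by rewrite -(ler_nat R) natrX natrM => h; lra.
  have h3 : (1 + 8 * p ^+ 3) ^+ (k ^ 2 * n) <= expR (p * (k%:R ^+ 2 / 8)).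
    apply: (@le_trans _ _ (expR (8 * p ^+ 3) ^+ (k ^ 2 * n))).
      apply: lerXn2r; rewrite ?nnegrE ?expR_ge0 ?expR_ge1Dx //.
      by rewrite addr_ge0 // mulr_ge0 // exprn_ge0 // ltW.
    rewrite -expRM_natl ler_expR natrM natrX -q2 le_eqVlt; apply/orP; left; apply/eqP.
    transitivity (8 * p * (p * q) ^+ 2 * k%:R ^+ 2); first by ring.
    by rewrite pq; field.
  have b0 : 0 <= 1 + 8 * p ^+ 3 by rewrite addr_ge0 // mulr_ge0 // exprn_ge0 // ltW.
  have a0 : 0 <= 1 - p by lra.
  apply: (@le_lt_trans _ _ (expR (k%:R * l) *
      (expR (- (p * (k%:R ^+ 2 / 4))) * expR (p * (k%:R ^+ 2 / 8))))).
    apply: ler_pM => //; first by rewrite mulr_ge0 ?exprn_ge0.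
    by apply: ler_pM; rewrite ?exprn_ge0.
  rewrite -!expRD -[ltRHS]expR0 ltr_expR.
  have : k%:R * (p * (64 * q * l)) < k%:R * (p * k%:R) by rewrite !ltr_pM2l.
  have -> : p * (64 * q * l) = 8 * l by rewrite [LHS](_ : _ = 64 * (p * q) * l); [rewrite pq; field|ring].
  by lra.
exists F; split=> //; apply/bigmax_leqP => A indA.
rewrite leqNgt; apply/negP; rewrite prednK ?(ltnW k2) // => kA.
have : (0 < #|[set B : {set 'I_n} | (B \subset A) && (#|B| == k)]%SET|)%N.
  by rewrite cards_draws bin_gt0.
move=> /card_gt0P[B]; rewrite inE => /andP[BA /eqP Bk].
have /negP := FS B Bk; apply; apply/forall_inP => e eF.
by apply: contra (forall_inP indA e eF) => eB; exact: fintype.subset_trans BA.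
Qed.

Lemma near_triangle_free (R : realType) (c : R) : 1 / 2 < c ->
  \forall n \near \oo, exists F : sgraph 'I_n,
    ~~ has_copy F (complete 3) /\ (alpha F)%:R <= (n%:R : R) `^ c.
Proof.
move=> c2; near=> n.
have n2 : (2 <= n)%N by near: n; exact: nbhs_infty_ge.
have n0 : (0 < n)%N by exact: ltnW.
have d0 : 0 < (c - 1 / 2) ^+ 2 by rewrite exprn_gt0 // subr_gt0.
have l1 : 1 <= ln (n%:R : R) by near: n; exact: near_ln_ge.
(* This makes [((c - 1 / 2) l / 2) ^+ 2] at least [64 l], and the exponential of [(c - 1 / 2) l] is
   at least that square. *)
have lb : 256 / (c - 1 / 2) ^+ 2 <= ln (n%:R : R) by near: n; exact: near_ln_ge.
set l := ln _ in l1 lb.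
set x := (n%:R : R) `^ c.
have xE : x = expR (l / 2) * expR ((c - 1 / 2) * l).
  by rewrite /x powR_expR // -expRD; congr expR; rewrite /l; field.
have e2 : 64 * l <= expR ((c - 1 / 2) * l).
  have h : (c - 1 / 2) * l / 2 <= expR ((c - 1 / 2) * l / 2).
    by apply: le_trans (expR_ge1Dx _); rewrite lerDr.
  have -> : (c - 1 / 2) * l = 2%:R * ((c - 1 / 2) * l / 2) by field.
  rewrite expRM_natl; set y := expR _ in h *.
  have h0 : 0 <= (c - 1 / 2) * l / 2 by rewrite divr_ge0 // mulr_ge0 // ?subr_ge0 ltW //; lra.
  have : ((c - 1 / 2) * l / 2) ^+ 2 <= y ^+ 2.
    by apply: lerXn2r; rewrite ?nnegrE // expR_ge0.
  apply: le_trans; move: lb; rewrite ler_pdivrMr // => lb.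
  have := ler_wpM2l (le_trans ler01 l1) lb.
  by rewrite -subr_ge0 => ?; rewrite -subr_ge0; lra.
have x0 : 0 <= x by rewrite powR_ge0.
have xl : 64 * expR (l / 2) * l <= x.
  by rewrite xE [64 * _]mulrC -mulrA ler_wpM2l ?expR_ge0.
have x1 : 1 <= x.
  have e1 (z : R) : 0 <= z -> 1 <= expR z by rewrite -[in X in _ -> X]expR0 ler_expR.
  by rewrite xE mulr_ege1 // e1 // ?divr_ge0 ?mulr_ge0 ?subr_ge0 //; lra.
have /andP[k1 k2] := truncn_itv x0.
have [|F [F3 aF]] := @triangle_free_expR R n (Num.truncn x).+1 n2 _ (le_lt_trans xl k2).
  by rewrite ltnS truncn_gt0.
by exists F; split=> //; apply: le_trans k1; rewrite ler_nat.
Unshelve. all: by end_near. Qed.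

(* With l = ln n and lam = (L / 2 - 1) / (6 l), the densities are
   d a = n ^ (- 3 lam ^ a) and q a is about lam ^ - a: this makes the second term
   at most 1, and the last density is bounded below by a constant as soon as
   L ^ s exceeds a large multiple of l ^ (s - 1), whence the exponent 1 - 1/s. *)
Lemma drc_parameters (R : realType) (n s : nat) (L K : R) :
  (0 < n)%N -> 0 < ln (n%:R : R) -> 4 <= L -> L <= ln n%:R ->
  K <= 3 * ln n%:R * (L / (24 * ln n%:R)) ^+ s ->
  exists (d : nat -> R) (q : nat -> nat), [/\ forall a, 0 < d a,
    forall a, n%:R * expR (- (L / 2)) <=
      n%:R * d a.+1 ^+ q a - n%:R ^+ 3 * d a ^+ q a &
    forall a, (a <= s)%N -> d a <= expR (- K)].
Proof.
move=> n0; set l := ln _ => l0 L4 Ll HK.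
(* As [q a * lam ^+ a <= 2], the first term is at least [expR (1 + l - L / 2)]. The [- 1] buys the
   factor [expR 1 >= 2], which pays for the subtracted term. *)
pose lam := (L / 2 - 1) / (6 * l).
have l6 : 0 < 6 * l by rewrite mulr_gt0.
have lamE : lam * (6 * l) = L / 2 - 1 by rewrite /lam divfK // gt_eqF.
have lam0 : 0 < lam by rewrite divr_gt0 //; lra.
have lam1 : lam <= 1 by rewrite ler_pdivrMr //; lra.
have nE : n%:R = expR l by rewrite lnK // posrE ltr0n.
pose q a := (Num.truncn (lam ^- a)).+1.
exists (fun a => expR (- (3 * l * lam ^+ a))), q; split.
- by move=> a; exact: expR_gt0.
- move=> a; have mu0 : 0 < lam ^+ a by rewrite exprn_gt0.
  have mu1 : lam ^+ a <= 1 by rewrite exprn_ile1 // ltW.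
  have /andP[q1 q2] := truncn_itv (ltW (mu0 : 0 < lam ^+ a) : 0 <= lam ^+ a).
  have imu : 0 <= lam ^- a by rewrite invr_ge0 ltW.
  have /andP[tq1 tq2] := truncn_itv imu.
  have qa1 : 1 <= (q a)%:R * lam ^+ a by rewrite -ler_pdivrMr // div1r ltW.
  have qa2 : (q a)%:R * lam ^+ a <= 2.
    have : (q a)%:R * lam ^+ a <= (lam ^- a + 1) * lam ^+ a.
      by rewrite ler_wpM2r ?(ltW mu0) // /q -natr1 lerD2r.
    by rewrite mulrDl mulVf ?gt_eqF // mul1r; lra.
  rewrite nE -!expRM_natl -!expRD.
  have h1 : expR (3%:R * l + (q a)%:R * - (3 * l * lam ^+ a)) <= 1.
    rewrite -[leRHS]expR0 ler_expR.
    by have := ler_wpM2l (ltW l0) qa1; lra.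
  have h2 : expR (1 + (l - L / 2)) <= expR (l + (q a)%:R * - (3 * l * lam ^+ a.+1)).
    rewrite ler_expR exprS.
    have := ler_wpM2l (ltW (mulr_gt0 l6 lam0)) qa2.
    by have := lamE; lra.
  have h3 : 1 <= expR (l - L / 2) by rewrite -[leLHS]expR0 ler_expR; lra.
  have h4 : 2 <= expR (1 : R) by have := expR_ge1Dx (1 : R); lra.
  have h5 : 2 * expR (l - L / 2) <= expR (1 + (l - L / 2)).
    by rewrite [leRHS]expRD ler_wpM2r ?expR_ge0.
  by lra.
- move=> a as_; rewrite ler_expR lerN2; apply: le_trans HK _.
  rewrite ler_pM2l ?mulr_gt0 //.
  have h : lam ^+ s <= lam ^+ a by apply: ler_wiXn2l => //; exact: ltW.
  apply: le_trans h; apply: lerXn2r; rewrite ?nnegrE ?(ltW lam0) //.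
    by rewrite divr_ge0 ?mulr_ge0 ?(ltW l0) //; lra.
  (* [L / (24 l) <= lam] is equivalent to [4 <= L]. *)
  rewrite /lam ler_pdivrMr ?mulr_gt0 // mulrAC ler_pdivlMr //.
  by have : 0 <= l * (L - 4) by [rewrite mulr_ge0 ?subr_ge0 // ltW]; lra.
Qed.

(** Slow growth gives [L <= ln n]. The exponent [1 - 1/s] makes [L ^+ s] equal to [omega n ^+ s]
    times [(ln n) ^+ s.-1], so all powers of [ln n] cancel in the last bound and [omega n] tending
    to infinity suffices. *)
Lemma near_gs_parameters (R : realType) (omega : nat -> R) (s : nat) (A K : R) :
  omega @ \oo --> +oo -> (2 <= s)%N ->
  (exists2 c : R, 1 / 2 < c &
     \forall n \near \oo, (n%:R : R) `^ c <= gs omega s n) ->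
  \forall n \near \oo, exists L : R,
    [/\ gs omega s n = n%:R * expR (- L), A <= L, L <= ln n%:R &
        K <= 3 * ln n%:R * (L / (24 * ln n%:R)) ^+ s].
Proof.
move=> /cvgryPge omega_infty s2 [c c2 slow]; near=> n.
have n0 : (0 < n)%N by near: n; exact: nbhs_infty_ge.
have l1 : 1 <= ln (n%:R : R) by near: n; exact: near_ln_ge.
have wB : 1 + `|A| + 24 ^+ s * `|K| <= omega n by near: n; exact: omega_infty.
have sl : (n%:R : R) `^ c <= gs omega s n by near: n.
exists (omega n * ln n%:R `^ (1 - s%:R^-1)).
set l := ln _ in l1 *; set w := omega n in wB *; set y := l `^ _.
have s0 : 0 < s%:R :> R by rewrite ltr0n ltnW.
have l0 : 0 < l by apply: lt_le_trans l1.
have y1 : 1 <= y.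
  rewrite -(powRr0 l) /y; apply: ler_powR => //.
  by rewrite subr_ge0 invf_le1 // ler1n ltnW.
have K0 : 0 <= 24 ^+ s * `|K| by rewrite mulr_ge0 // exprn_ge0.
have A0 := normr_ge0 A.
have w1 : 1 <= w by lra.
have w0 : 0 <= w by lra.
have wy : w <= w * y by rewrite ler_peMr.
have gsE : gs omega s n = n%:R * expR (- (w * y)) by rewrite /gs expRN.
split=> //.
- by have := ler_norm A; lra.
- have nE : n%:R = expR l by rewrite lnK // posrE ltr0n.
  move: sl; rewrite gsE powR_expR // -/l nE -expRD ler_expR => h.
  have : 0 <= l * c by rewrite mulr_ge0 ?(ltW l0) //; lra.
  by lra.
have ys : y ^+ s = l ^+ s.-1.
  rewrite -powR_mulrn ?powR_ge0 // -powRrM mulrBl mulVf ?gt_eqF // mul1r.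
  rewrite -powR_mulrn ?(ltW l0) //; congr (_ `^ _).
  by rewrite -[in LHS](prednK (ltnW s2)) -natr1 addrK.
have -> : 3 * l * (w * y / (24 * l)) ^+ s = 3 * w ^+ s / 24 ^+ s.
  rewrite expr_div_n exprMn ys exprMn -[in l ^+ s](prednK (ltnW s2)) exprS.
  have ls0 : l ^+ s.-1 != 0 by rewrite expf_neq0 // gt_eqF.
  have c0 : 24 ^+ s != 0 :> R by rewrite expf_neq0 // pnatr_eq0.
  by field; rewrite ls0 c0 gt_eqF.
rewrite ler_pdivlMr ?exprn_gt0 //.
have ws : w <= w ^+ s by rewrite -[leLHS]expr1; apply: ler_weXn2l => //; exact: ltnW.
have : K * 24 ^+ s <= `|K| * 24 ^+ s by rewrite ler_wpM2r ?exprn_ge0 // ler_norm.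
by lra.
Unshelve. all: by end_near. Qed.

(** * The two asymptotic bounds on the Ramsey-Turan number *)

Lemma RT_upper (R : realType) (omega : nat -> R) (s N r p : nat) (eps : R) :
  omega @ \oo --> +oo -> (2 <= s)%N ->
  (exists2 c : R, 1 / 2 < c &
     \forall n \near \oo, (n%:R : R) `^ c <= gs omega s n) ->
  arrows 3 s N ->
  (r = N /\ p = 2 * s - 1 \/ r = N.+1 /\ p = 2 * s)%N -> (2 <= r)%N -> 0 < eps ->
  \forall n \near \oo,
    (RT n (complete 3) (complete p) (gs omega s n))%:R <=
    1 / 2 * (1 - 1 / (r.-1)%:R) * n%:R ^+ 2 + eps * n%:R ^+ 2 :> R.
Proof.
move=> omega_infty s2 slow arr rp r2 eps0.
pose eta : R := Num.min 1 eps.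
have eta0 : 0 < eta by rewrite lt_min ltr01.
have eta1 : eta <= 1 by rewrite ge_min lexx.
have etae : eta <= eps by rewrite ge_min lexx orbT.
pose dens : R := eta ^+ r.-1 / 4 ^+ r.
have dens0 : 0 < dens by rewrite divr_gt0 ?exprn_gt0.
(* [A <= L] ensures [2 * expR (- (L / 2)) <= eps], the loss caused by the colour-1 edges at [W]. *)
pose A : R := 4 - 2 * ln (eps / 2).
have A4 : Num.max 4 A >= 4 by rewrite le_max lexx.
near=> n.
have [L [gsE AL Ll KL]] : exists L : R,
    [/\ gs omega s n = n%:R * expR (- L), Num.max 4 A <= L, L <= ln n%:R &
        - ln dens <= 3 * ln n%:R * (L / (24 * ln n%:R)) ^+ s].
  by near: n; exact: near_gs_parameters.
have n0 : (0 < n)%N by near: n; exact: nbhs_infty_ge.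
have l0 : 0 < ln (n%:R : R).
  by apply: lt_le_trans Ll; apply: lt_le_trans AL; apply: lt_le_trans A4.
have L4 : 4 <= L by apply: le_trans AL.
have nr0 : 0 < n%:R :> R by rewrite ltr0n.
have r10 : 0 < (r.-1)%:R :> R by rewrite ltr0n -ltnS prednK // ltnW.
have ir1 : 1 / (r.-1)%:R <= 1 :> R.
  by rewrite ler_pdivrMr // mul1r ler1n -ltnS prednK // ltnW.
have ir0 : 0 <= 1 / (r.-1)%:R :> R by rewrite divr_ge0 // ltW.
have n20 : 0 <= n%:R ^+ 2 :> R by rewrite exprn_ge0.
have b0 : 0 <= 1 / 2 * (1 - 1 / (r.-1)%:R) * n%:R ^+ 2 + eps * n%:R ^+ 2 :> R.
  by rewrite addr_ge0 ?mulr_ge0 ?subr_ge0 // ltW.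
(* The maximum is a natural number, so the real bound is truncated to be compared with each graph
   separately. *)
rewrite -truncn_ge_nat //; apply/bigmax_leqP => G /andP[Gfree Ga].
rewrite truncn_ge_nat // leNgt; apply/negP => Gbig.
have [phi /andP[phi3 /negP phip]] := existsP Gfree.
have [d [q [d0 dq ds]]] := drc_parameters n0 l0 L4 Ll KL.
apply: phip; pose m : R := n%:R * expR (- (L / 2)).
have gm : gs omega s n / m = expR (- (L / 2)).
  rewrite gsE /m invfM mulrACA divff ?gt_eqF // mul1r -expRN -expRD.
  by congr expR; field.
have small : 2 * expR (- (L / 2)) <= eps.
  rewrite mulrC -ler_pdivlMr // -[leRHS]lnK ?posrE ?divr_gt0 // ler_expR.
  have : A <= L by apply: le_trans AL; rewrite le_max lexx orbT.
  by rewrite /A; lra.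
apply: (@second_colour_clique R 'I_n G phi N s r p eta (gs omega s n) m d q arr rp r2)
  => //.
- by rewrite card_ord.
- by rewrite mulr_gt0 // expR_gt0.
- by move=> a _; rewrite card_ord; exact: dq.
- by move=> a sa; have := ds a sa; rewrite opprK lnK.
rewrite card_ord gm.
(* The surplus [2 eps n^2] of ordered pairs is split evenly: one half for supersaturation, the other
   for the edges at [W]. *)
have h1 : eta / (r.-1)%:R <= eps.
  by apply: le_trans etae; rewrite ler_pdivrMr // ler_peMr ?(ltW eta0) // ler1n -ltnS prednK // ltnW.
have := ler_wpM2r n20 h1; have := ler_wpM2r n20 small.
by move: Gbig; rewrite mulrBl; lra.
Unshelve. all: by end_near. Qed.

Lemma RT_lower (R : realType) (omega : nat -> R) (s M P p : nat) (eps : R) :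
  (2 <= s)%N ->
  (exists2 c : R, 1 / 2 < c &
     \forall n \near \oo, (n%:R : R) `^ c <= gs omega s n) ->
  ~~ arrows 3 s M -> (0 < P)%N ->
  (P = M /\ p = 2 * s - 1 \/ P = M.+1 /\ p = 2 * s)%N -> 0 < eps ->
  \forall n \near \oo,
    1 / 2 * (1 - 1 / P%:R) * n%:R ^+ 2 - eps * n%:R ^+ 2 <=
    (RT n (complete 3) (complete p) (gs omega s n))%:R :> R.
Proof.
move=> s2 [c c2 slow] arr P0 hp eps0; near=> n.
have [F [F3 aF]] : exists F : sgraph 'I_n,
    ~~ has_copy F (complete 3) /\ (alpha F)%:R <= (n%:R : R) `^ c.
  by near: n; exact: near_triangle_free.
have sl : (n%:R : R) `^ c <= gs omega s n by near: n.
(* The rounding loss of the part sizes, [n / 2] edges, is absorbed by [eps n^2]. *)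
have nl : 1 / eps <= n%:R by near: n; exact: nbhs_infty_ger.
have [G [G1 G2 G3]] := @ramsey_turan_lower R n M s p P F arr (ltnW s2) P0 hp F3.
have hG : (#|edges G| <= RT n (complete 3) (complete p) (gs omega s n))%N.
  apply: (leq_bigmax_cond (F := fun G : sgraph 'I_n => #|edges G|)).
  rewrite G1 /=; apply: le_trans sl; apply: le_trans aF.
  by rewrite ler_nat.
have : #|edges G|%:R <= (RT n (complete 3) (complete p) (gs omega s n))%:R :> R.
  by rewrite ler_nat.
apply: le_trans; move: nl; rewrite ler_pdivrMr // => nl.
have := ler_wpM2l (ler0n R n) nl; move: G3; rewrite expr2.
have := ler0n R n; lra.
Unshelve. all: by end_near. Qed.

Lemma ramsey_gt1 (s : nat) : (2 <= s)%N -> (1 < ramsey 3 s)%N.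
Proof.
move=> s2; rewrite /ramsey; case: ex_minnP => N arrN _.
rewrite ltnNge; apply/negP => N1; move: arrN; apply/negP.
rewrite negb_forall; apply/existsP; exists [ffun=> true].
have nocopy k (G : sgraph 'I_N) : (2 <= k)%N -> ~~ has_copy G (complete k).
  move=> k2; apply/existsP => -[f /andP[/injectiveP finj _]].
  have := leq_card f finj; rewrite !card_ord => kN.
  by have := leq_trans k2 (leq_trans kN N1).
by rewrite negb_or !nocopy.
Qed.

(** The bounds meet because the construction has [r.-1] parts while the upper bound only needs the
    density forcing [r]-cliques; one uses that [ramsey 3 s] arrows, the other that its predecessor
    does not. *)
Lemma RT_asymptotics (R : realType) (omega : nat -> R) (s r p : nat) :
  omega @ \oo --> +oo -> (2 <= s)%N ->
  (exists2 c : R, 1 / 2 < c &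
     \forall n \near \oo, (n%:R : R) `^ c <= gs omega s n) ->
  (r = ramsey 3 s /\ p = 2 * s - 1 \/ r = (ramsey 3 s).+1 /\ p = 2 * s)%N ->
  (fun n : nat => (RT n (complete 3) (complete p) (gs omega s n))%:R : R) =
  (fun n : nat => 1 / 2 * (1 - 1 / (r.-1)%:R) * n%:R ^+ 2)
    +o_\oo (fun n : nat => n%:R ^+ 2 : R).
Proof.
move=> omega_infty s2 slow; have := ramsey_gt1 s2.
rewrite /ramsey; case: ex_minnP => N arrN minN N2 hr.
have Nk k : (k < N)%N -> ~~ arrows 3 s k.
  by move=> kN; apply/negP => /minN; rewrite leqNgt kN.
have r2 : (2 <= r)%N by case: hr => -[-> _] //; exact: ltnW.
apply/eqaddoP => eps eps0.
have hP : (r.-1 = N.-1 /\ p = 2 * s - 1 \/ r.-1 = N.-1.+1 /\ p = 2 * s)%N.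
  case: hr => -[-> ->]; [by left|right]; split=> //.
  by rewrite (prednK (ltnW N2)).
have P0 : (0 < r.-1)%N by rewrite -ltnS prednK // ltnW.
have arrM : ~~ arrows 3 s N.-1 by apply: Nk; rewrite prednK // ltnW.
near=> n.
have up : (RT n (complete 3) (complete p) (gs omega s n))%:R <=
    1 / 2 * (1 - 1 / (r.-1)%:R) * n%:R ^+ 2 + eps * n%:R ^+ 2 :> R.
  by near: n; exact: RT_upper hr r2 eps0.
have lo : 1 / 2 * (1 - 1 / (r.-1)%:R) * n%:R ^+ 2 - eps * n%:R ^+ 2 <=
    (RT n (complete 3) (complete p) (gs omega s n))%:R :> R.
  by near: n; exact: RT_lower arrM P0 hP eps0.
rewrite !fctE [`|n%:R ^+ 2|]ger0_norm ?exprn_ge0 // ler_norml.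
by apply/andP; split; lra.
Unshelve. all: by end_near. Qed.

(* omega is understood to grow slowly: without omega_slow the statement fails,
   e.g. for omega n = n no graph has independence number at most gs omega s n.
   The hypothesis amounts to omega n <= (1 - c) (ln n)^(1/s) for large n; at
   exponents c < 1/2 there are, for large n, no triangle-free graphs on n vertices with
   independence number at most n^c. *)
Theorem theorem1p2 (R : realType) (omega : nat -> R)
  (omega_infty : omega @ \oo --> +oo)
  (s : nat) (s_ge2 : (2 <= s)%N)
  (omega_slow : exists2 c : R, 1 / 2 < c &
     \forall n \near \oo, (n%:R : R) `^ c <= gs omega s n) :
  ((fun n : nat => (RT n (complete 3) (complete (2 * s - 1)) (gs omega s n))%:R : R) =
   (fun n : nat => 1 / 2 * (1 - 1 / ((ramsey 3 s)%:R - 1)) * n%:R ^+ 2)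
     +o_\oo (fun n : nat => n%:R ^+ 2 : R))
  /\
  ((fun n : nat => (RT n (complete 3) (complete (2 * s)) (gs omega s n))%:R : R) =
   (fun n : nat => 1 / 2 * (1 - 1 / (ramsey 3 s)%:R) * n%:R ^+ 2)
     +o_\oo (fun n : nat => n%:R ^+ 2 : R)).
Proof.
have s1 : (ramsey 3 s)%:R - 1 = (ramsey 3 s).-1%:R :> R.
  by rewrite -[in LHS](prednK (ltnW (ramsey_gt1 s_ge2))) -natr1 addrK.
split; first by rewrite s1; apply: RT_asymptotics => //; left.
by apply: (@RT_asymptotics _ _ _ (ramsey 3 s).+1) => //; right.
Qed.
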